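(* Let $D\subset\mathbb R^d$, $d\in\{2,3\}$, be a bounded Lipschitz domain, let $\mathcal S\colon L^\infty_+(D)\times L^2(D)\to H_0^1(D)$ be the solution operator of the elliptic diffusion problem, and let $c$ be the Poincaré constant of $D$. Let $p\ge1$, $r<\infty$, and let $P,Q$ be probability measures on $L^\infty_+(D)\times L^2(D)$ with supports $$\operatorname{supp}P,\ \operatorname{supp}Q\subseteq\{(a,f)\in L^\infty_+(D)\times L^2(D)\colon \|\log a\|_{L^\infty(D)}\le r,\ \|f\|_{L^2(D)}\le r\}.$$ Then the pushforward measures satisfy $\mathcal S_*P,\mathcal S_*Q\in\mathcal P_p(H_0^1(D))$ and $$d_p(\mathcal S_*P,\mathcal S_*Q)\le c(1+r)e^{3r}\,d_p(P,Q).$$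
   Context: $L^\infty_+(D):=\{a\in L^\infty(D)\colon\operatorname{ess\,inf}a>0\}$. For $(a,f)\in L^\infty_+(D)\times L^2(D)$, $\mathcal S(a,f)$ is the unique $u\in H_0^1(D)$ with $(a\nabla u,\nabla v)_{L^2(D)}=(f,v)_{L^2(D)}$ for all $v\in H_0^1(D)$. The norm is $\|v\|_{H_0^1(D)}=\|\nabla v\|_{L^2(D)}$ and $c$ satisfies $\|v\|_{L^2(D)}\le c\|\nabla v\|_{L^2(D)}$ for all $v\in H_0^1(D)$. The data space $L^\infty_+(D)\times L^2(D)$ is equipped with the metric $d((a_1,f_1),(a_2,f_2))=\|\log a_1-\log a_2\|_{L^\infty(D)}+\|f_1-f_2\|_{L^2(D)}$ and $H_0^1(D)$ with the metric induced by its norm; measures are Borel. On a metric space $(\mathcal X,d)$, $\mathcal P_p(\mathcal X)$ is the set of Borel probability measures $P$ with $\int d(x,x_0)^p\,P(dx)<\infty$ for some $x_0$, and $d_p(P,Q)=\inf_{\pi}(\iint d(x,y)^p\,\pi(dx,dy))^{1/p}$, the infimum over all Borel probability measures $\pi$ on $\mathcal X\times\mathcal X$ with marginals $P$ and $Q$. *)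

(* Defs.v *)
From HB Require Import structures.
From mathcomp Require Import all_boot all_order all_algebra.
From mathcomp Require Import all_classical all_reals all_analysis.
From mathcomp Require Import measurable_realfun ess_sup_inf.

Set Implicit Arguments.
Unset Strict Implicit.
Unset Printing Implicit Defensive.
Import Order.TTheory GRing.Theory Num.Theory.
Import numFieldNormedType.Exports.

Local Open Scope classical_set_scope.
Local Open Scope ring_scope.

(** * Borel measures and Wasserstein distances

   The metric space is given by a type and an explicit distance function
   rather than by a [metricType]: the separation axiom for the distance
   ||grad u - grad v|| on H_0^1(D) is the Poincare inequality, so that there is
   no unconditional [metricType] instance.  None of the notions below depends
   on the metric axioms. *)

Section metric_measures.
Context {R : realType} {X : pointedType}.
Variable dist : X -> X -> R.

Definition dist_open (U : set X) :=
  forall x, U x -> exists2 e : R, 0 < e & forall y, dist x y < e -> U y.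

Definition dist_borel := g_sigma_algebraType dist_open.

(* [C] is the smallest closed set of full measure.  On a non-separable space
   the set of points all of whose neighbourhoods have positive measure need not
   carry the measure; when it does, it is the set described here. *)
Definition is_support (P : probability dist_borel R) (C : set X) :=
  [/\ dist_open (~` C), P (~` C) = 0%E &
      forall C' : set X, dist_open (~` C') -> P (~` C') = 0%E -> C `<=` C'].

Definition wasserstein_space (p : R) : set (probability dist_borel R) :=
  [set P : probability dist_borel R | exists x0 : X,
     (\int[P]_x ((dist x x0) `^ p)%:E < +oo)%E].

End metric_measures.

Section wasserstein.
Context {R : realType} {X : pointedType}.
Variable dist : X -> X -> R.

Definition prod_dist (z w : X * X) : R :=
  Num.max (dist z.1 w.1) (dist z.2 w.2).

(* A coupling lives on the Borel sigma-algebra of the product topology, which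
   is larger than the product of the Borel sigma-algebras if [X] is not
   separable. *)
Definition coupling (P Q : probability (dist_borel dist) R) :
    set (probability (dist_borel prod_dist) R) :=
  [set pi : probability (dist_borel prod_dist) R |
    forall A : set (dist_borel dist), measurable A ->
     pi (fst @^-1` A) = P A /\ pi (snd @^-1` A) = Q A].

(* The value is +oo if there is no coupling. *)
Definition wasserstein (p : R) (P Q : probability (dist_borel dist) R) :
    \bar R :=
  ereal_inf [set (poweR (\int[pi]_z ((dist z.1 z.2) `^ p)%:E) p^-1)%E
            | pi in coupling P Q].

End wasserstein.

(** * Lebesgue measure on R^d *)

Section lebesgue_tuple.
Context {R : realType}.
Local Notation T := (measurableTypeR R).

Definition tcons n (z : T * n.-tuple T) : n.+1.-tuple T := [tuple of z.1 :: z.2].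

Lemma measurable_tcons n : measurable_fun [set: T * n.-tuple T] (@tcons n).
Proof. exact: measurable_cons. Qed.

HB.instance Definition _ n :=
  @isMeasurableFun.Build _ _ _ _ (@tcons n) (@measurable_tcons n).

Section step.
Variables (n : nat) (mu : {sigma_finite_measure set (n.-tuple T) -> \bar R}).

Definition lebesgue_tuple_step : set (n.+1.-tuple T) -> \bar R :=
  pushforward (@lebesgue_measure R \x mu)%E (@tcons n).

Let step0 : lebesgue_tuple_step set0 = 0%E.
Proof. exact: measure0. Qed.

Let step_ge0 A : (0 <= lebesgue_tuple_step A)%E.
Proof. exact: measure_ge0. Qed.

Let step_sigma_additive : semi_sigma_additive lebesgue_tuple_step.
Proof. exact: measure_semi_sigma_additive. Qed.

HB.instance Definition _ := isMeasure.Build _ _ _ lebesgue_tuple_step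
  step0 step_ge0 step_sigma_additive.

Let step_sigma_finite : sigma_finite setT lebesgue_tuple_step.
Proof.
have /sigma_finiteP[F [FT ndF Foo]] := sigma_finiteT (@lebesgue_measure R).
have /sigma_finiteP[G [GT ndG Goo]] := sigma_finiteT mu.
exists (fun k => [set t : n.+1.-tuple T | F k (thead t)] `&`
                 [set t : n.+1.-tuple T | G k [tuple of behead t]]).
  apply/esym; rewrite -subTset => t _.
  have : [set: T] (thead t) by [].
  have : [set: n.-tuple T] [tuple of behead t] by [].
  rewrite FT GT => -[k _ Gk] [m _ Fm]; exists (maxn k m) => //; split.
    by have /subsetPset := ndF _ _ (leq_maxr k m); apply.
  by have /subsetPset := ndG _ _ (leq_maxl k m); apply.
move=> k; have [mF Fk] := Foo k; have [mG Gk] := Goo k; split.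
  apply: measurableI; rewrite -[X in measurable X]setTI.
    exact: (measurable_tnth ord0).
  exact: measurable_behead.
rewrite /lebesgue_tuple_step /pushforward [X in (_ X < _)%E](_ : _ = F k `*` G k).
  by rewrite product_measure1E// lte_mul_pinfty// ge0_fin_numE.
have beheadK z : [tuple of behead (@tcons n z)] = z.2 by exact: val_inj.
by apply/seteqP; split => z /=; rewrite /preimage/= beheadK.
Qed.

HB.instance Definition _ := Measure_isSigmaFinite.Build _ _ _ lebesgue_tuple_step
  step_sigma_finite.

End step.

Fixpoint lebesgue_tuple n : {sigma_finite_measure set (n.-tuple T) -> \bar R} :=
  if n is n'.+1 then lebesgue_tuple_step (lebesgue_tuple n')
  else \d_[tuple of [::]].

Lemma lebesgue_tuple_box n (A : 'I_n -> set T) :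
    (forall i, measurable (A i)) ->
  lebesgue_tuple n [set t | forall i, A i (tnth t i)] =
  (\prod_(i < n) lebesgue_measure (A i))%E.
Proof.
elim: n A => [|n IH] A mA /=.
  by rewrite big_ord0 /= diracE mem_set// => -[].
rewrite big_ord_recl -IH// /lebesgue_tuple_step /pushforward.
rewrite -product_measure1E//.
  congr product_measure1; apply/seteqP; split => -[x t] /=.
    move=> h; split; first by have := h ord0.
    by move=> i; have := h (lift ord0 i); rewrite tnthS.
  move=> [h0 h] i; have [j ->|->//] := unliftP ord0 i.
  by rewrite tnthS; exact: h.
rewrite (_ : [set _ | _] = \bigcap_(i in [set: 'I_n])
    ((fun t => tnth t i) @^-1` A (lift ord0 i))); last first.
  by apply/seteqP; split => t /= h i => [_|]; exact: h.
apply: fin_bigcap_measurable => // i _.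
by rewrite -[X in measurable X]setTI; exact: measurable_tnth.
Qed.

End lebesgue_tuple.

Section lebesgue_rV.
Context {R : realType} (d : nat).
Local Notation T := (measurableTypeR R).

Definition rVborel := g_sigma_algebraType (@open 'rV[R]_d).

Definition row_of_tuple (t : d.-tuple T) : rVborel := \row_i tnth t i.

Lemma measurable_row_of_tuple : measurable_fun setT row_of_tuple.
Proof.
apply: (@measurability _ _ _ rVborel setT row_of_tuple (@open 'rV[R]_d)) => // _ [U oU <-].
rewrite setTI.
pose B (z : 'rV[rat]_d * nat) : set (d.-tuple T) :=
  [set t | forall i, ball (ratr (z.1 0 i) : R) z.2.+1%:R^-1 (tnth t i)].
have mB z : measurable (B z).
  rewrite (_ : B z = \bigcap_(i in [set: 'I_d])
      ((fun t => tnth t i) @^-1` ball (ratr (z.1 0 i) : R) z.2.+1%:R^-1)).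
    apply: fin_bigcap_measurable => // i _.
    rewrite -[X in measurable X]setTI; apply: measurable_tnth => //.
    exact: measurable_ball.
  by apply/seteqP; split => t /= h i => [_|]; exact: h.
rewrite (_ : _ @^-1` _ = \bigcup_z
    (if `[< B z `<=` row_of_tuple @^-1` U >] then B z else set0)).
  apply: countable_bigcupT_measurable; first exact: countableP.
  by move=> z; case: ifPn.
apply/seteqP; split => [t /= Ut|t [z _]]; last first.
  by case: ifPn => // /asboolP; apply.
have /nbhs_ballP[e /= e0 eU] : nbhs (row_of_tuple t : 'rV[R]_d) U.
  exact: open_nbhs_nbhs.
have [k ke] : exists k : nat, k.+1%:R^-1 < e / 2.
  have := @near_infty_natSinv_lt R (PosNum (divr_gt0 e0 (ltr0n _ 2))).
  by move=> [k _ /(_ k (leqnn k))] ke; exists k.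
have q_ i : {q : rat | ball (ratr q : R) k.+1%:R^-1 (tnth t i)}.
  apply: cid; have [] := @dense_rat R (ball (tnth t i : R) k.+1%:R^-1).
  - by exists (tnth t i); exact: ballxx.
  - exact: ball_open.
  - by move=> x [tx [q _ qx]]; exists q; rewrite qx; exact: ball_sym.
pose z := (\row_i sval (q_ i), k).
have Bt : B z t by move=> i /=; rewrite mxE; exact: (svalP (q_ i)).
exists z => //; rewrite asboolT// => s Bs; apply: eU; split => // i j.
rewrite /row_of_tuple !mxE (splitr e); apply: (@ball_triangle _ _ (ratr (z.1 0 j) : R)).
  by apply/ball_sym/(le_ball (ltW ke)); exact: Bt.
by apply/(le_ball (ltW ke)); exact: Bs.
Qed.

HB.instance Definition _ :=
  @isMeasurableFun.Build _ _ _ _ row_of_tuple measurable_row_of_tuple.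

Definition lebesgue_rV : set rVborel -> \bar R :=
  pushforward (lebesgue_tuple d) row_of_tuple.

Let lebesgue_rV0 : lebesgue_rV set0 = 0%E.
Proof. exact: measure0. Qed.

Let lebesgue_rV_ge0 A : (0 <= lebesgue_rV A)%E.
Proof. exact: measure_ge0. Qed.

Let lebesgue_rV_sigma_additive : semi_sigma_additive lebesgue_rV.
Proof. exact: measure_semi_sigma_additive. Qed.

HB.instance Definition _ := isMeasure.Build _ _ _ lebesgue_rV
  lebesgue_rV0 lebesgue_rV_ge0 lebesgue_rV_sigma_additive.

Lemma lebesgue_rV_box (A : 'I_d -> set T) : (forall i, measurable (A i)) ->
  lebesgue_rV [set x : 'rV[R]_d | forall i, A i (x 0 i)] =
  (\prod_(i < d) lebesgue_measure (A i))%E.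
Proof.
move=> mA; rewrite -lebesgue_tuple_box// /lebesgue_rV /pushforward.
congr (lebesgue_tuple d _); apply/seteqP.
by split => t /= h i; have := h i; rewrite mxE.
Qed.

Lemma open_rVborel (U : set 'rV[R]_d) : open U -> measurable (U : set rVborel).
Proof. exact: sub_sigma_algebra. Qed.

End lebesgue_rV.
Arguments rVborel R d : clear implicits.
Arguments lebesgue_rV R d : clear implicits.

(** * Bounded Lipschitz domains *)

Section domain.
Context {R : realType} (d : nat).
Implicit Types x y nu : 'rV[R]_d.

Definition dotr x y : R := \sum_(i < d) x 0 i * y 0 i.

(* Near every boundary point, [D] is the strict epigraph of a Lipschitz
   function over the hyperplane orthogonal to some unit vector [nu].  The
   function is defined on all of R^d but only evaluated on that hyperplane;
   this avoids choosing coordinates adapted to [nu], and is no restriction as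
   a Lipschitz function on the hyperplane extends by orthogonal projection. *)
Definition lipschitz_boundary (D : set 'rV[R]_d) :=
  forall x, (closure D `\` D) x ->
  exists (rho : R) (nu : 'rV[R]_d) (gamma : 'rV[R]_d -> R) (K : R),
    [/\ 0 < rho, dotr nu nu = 1,
        forall y z, `|gamma y - gamma z| <= K * `|y - z| &
        forall y, ball x rho y ->
          D y <-> gamma (y - dotr y nu *: nu) < dotr y nu].

Record lipschitz_domain := LipschitzDomain {
  domain :> set 'rV[R]_d ;
  domain_open : open domain ;
  domain_nonempty : domain !=set0 ;
  domain_connected : connected domain ;
  domain_bounded : bounded_set domain ;
  domain_lipschitz : lipschitz_boundary domain }.

End domain.
Arguments lipschitz_domain R d : clear implicits.
Arguments domain_open {R d} l.

(** * Test functions *)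

Section test_functions.
Context {R : realType} {d : nat}.
Implicit Types f : 'rV[R]_d -> R.

Definition partial (i : 'I_d) f : 'rV[R]_d -> R :=
  fun x => 'D_(delta_mx 0 i) f x.

Fixpoint is_Ck (k : nat) f : Prop :=
  continuous f /\
  if k is k'.+1 then
    forall i : 'I_d, (forall x, derivable f x (delta_mx 0 i)) /\
                     is_Ck k' (partial i f)
  else True.

Definition test_function (D : set 'rV[R]_d) f :=
  [/\ forall k, is_Ck k f,
      compact (closure [set x | f x != 0]) &
      closure [set x | f x != 0] `<=` D].

Lemma partial_cst i (a : R) : partial i (cst a) = cst 0.
Proof. by apply/funext => x; rewrite /partial derive_cst. Qed.

Lemma is_Ck_cst k (a : R) : is_Ck k (cst a).
Proof.
elim: k a => [|k IH] a; (split; first exact: cst_continuous) => // i.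
by rewrite partial_cst; split => // x; exact: derivable_cst.
Qed.

Lemma test_function0 D : test_function D (cst 0).
Proof.
rewrite /test_function (_ : [set x | _] = set0); last first.
  by apply/seteqP; split => // x /=; rewrite eqxx.
rewrite closure0; split => //; [by move=> k; exact: is_Ck_cst|exact: compact0].
Qed.

Lemma continuous_rVborel f :
  continuous f -> measurable_fun [set: rVborel R d] (f : rVborel R d -> R).
Proof.
move=> /continuousP cf.
apply: (measurability _ (RGenOpens.measurableE R)) => _ [_ [a [b ->] <-]].
by rewrite setTI; apply: open_rVborel; exact/cf/interval_open.
Qed.

End test_functions.

(** * Function spaces on a domain *)

Section spaces.
Context {R : realType} {d : nat} (D : lipschitz_domain R d).

Definition lebesgue_on : set (rVborel R d) -> \bar R :=
  mrestr (lebesgue_rV R d) (open_rVborel (domain_open D)).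

HB.instance Definition _ := Measure.on lebesgue_on.

Definition L2 := LspaceType lebesgue_on (lee1n 2).
Definition Linfty := LspaceType lebesgue_on (leey 1%E).
Identity Coercion L2_LspaceType : L2 >-> LspaceType.
Identity Coercion Linfty_LspaceType : Linfty >-> LspaceType.

Definition L2norm (f : rVborel R d -> R) : \bar R :=
  'N[lebesgue_on]_2%:E [EFin \o f].

Definition Linfty_norm (f : rVborel R d -> R) : \bar R :=
  'N[lebesgue_on]_+oo%E [EFin \o f].

Local Notation mfun_class :=
  {mfun_ lebesgue_on, rVborel R d >-> measurableTypeR R}.

Lemma measurable_class (f : mfun_class) :
  measurable_fun [set: rVborel R d] (f : rVborel R d -> R).
Proof. exact: (@measurable_funPT _ _ _ _ (repr f)). Qed.

Definition cst_class (a : R) : mfun_class :=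
  (\pi_mfun_class (cst a))%qT.

Lemma cst_classE (a : R) : ae_eq lebesgue_on setT (cst_class a) (cst a).
Proof.
have /eqmodP/asboolP : (repr (cst_class a) = cst a %[mod mfun_class])%qT.
  by rewrite reprK.
by apply: filterS => x + _; apply.
Qed.

Let L2norm_cst0 : L2norm (cst_class 0) = 0%E.
Proof.
rewrite /L2norm unlock.
have -> : (\int[lebesgue_on]_x (`|(EFin \o cst_class 0%R) x| `^ 2) = 0)%E.
  rewrite -[RHS](@integral0 _ _ _ lebesgue_on setT).
  apply: ae_eq_integral => //.
    apply: (measurableT_comp (measurable_poweR _)) => //.
    apply: measurableT_comp => //.
    by apply/measurable_EFinP; exact: measurable_class.
  by apply: filterS (cst_classE 0) => x /(_ I) /= ->; rewrite normr0 powR0.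
by rewrite poweR0r.
Qed.

Let L2_cst0 : finite_norm lebesgue_on 2%:E (cst_class 0).
Proof. by rewrite /finite_norm (L2norm_cst0 : 'N[_]__[_] = _)%E ltry. Qed.

Definition L2_zero : L2 := HB.pack_for L2 (cst_class 0)
  (isFinLebesgue.Build _ _ _ lebesgue_on 2%:E (lee1n 2) (cst_class 0) L2_cst0).

Let Linfty_cst1 : finite_norm lebesgue_on +oo%E (cst_class 1).
Proof.
rewrite /finite_norm unlock; case: ifPn => // _.
apply: (@le_lt_trans _ _ 1%E); last exact: ltry.
by apply/ess_supP; apply: filterS (cst_classE 1) => x /(_ I) /= ->; rewrite normr1.
Qed.

Definition Linfty_one : Linfty := HB.pack_for Linfty (cst_class 1)
  (isFinLebesgue.Build _ _ _ lebesgue_on +oo%E (leey 1%E) (cst_class 1)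
     Linfty_cst1).

Record Linfty_pos := LinftyPos {
  Linfty_pos_val :> Linfty ;
  Linfty_pos_gt0 : (0 < ess_inf lebesgue_on (EFin \o Linfty_pos_val))%E }.

Lemma Linfty_one_gt0 : (0 < ess_inf lebesgue_on (EFin \o Linfty_one))%E.
Proof.
apply: (@lt_le_trans _ _ 1%E); first by rewrite lte_fin.
by apply/ess_infP; apply: filterS (cst_classE 1) => x /(_ I) /= ->.
Qed.

(* A function of H^1(D) is stored with its weak gradient, which it determines
   up to almost everywhere equality. *)
Record H1 := MkH1 {
  H1_val :> L2 ;
  H1_grad : 'I_d -> L2 ;
  H1_weak_gradient : forall (phi : 'rV[R]_d -> R) (i : 'I_d),
    test_function D phi ->
    (\int[lebesgue_on]_x (H1_val x * partial i phi x) =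
     - \int[lebesgue_on]_x (H1_grad i x * phi x))%R }.

(* The closure of the test functions in H^1(D) *)
Record H01 := MkH01 {
  H01_H1 :> H1 ;
  H01_closure : forall e : R, 0 < e ->
    exists2 phi, test_function D phi &
      (L2norm (fun x => H1_val H01_H1 x - phi x)%R < e%:E)%E /\
      forall i, (L2norm (fun x => H1_grad H01_H1 i x - partial i phi x)%R < e%:E)%E }.

Let L2_zeroE : ae_eq lebesgue_on setT L2_zero (cst 0).
Proof. exact: cst_classE. Qed.

Let integral_L2_zero f : continuous f ->
  \int[lebesgue_on]_x (L2_zero x * f x) = 0.
Proof.
move=> cf; rewrite /Rintegral.
rewrite (_ : (\int[lebesgue_on]_x (L2_zero x * f x)%:E) = 0)%E//.
rewrite -[RHS](@integral0 _ _ _ lebesgue_on setT); apply: ae_eq_integral => //.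
  apply/measurable_EFinP; apply: measurable_funM.
    exact: measurable_class.
  exact: continuous_rVborel.
by apply: filterS L2_zeroE => x /(_ I) /= -> _; rewrite mul0r.
Qed.

Definition H1_zero : H1.
Proof.
refine (@MkH1 L2_zero (fun=> L2_zero) _) => phi i [/(_ 1%N)[cphi /(_ i)[_]]].
by move=> [cpphi _] _ _; rewrite !integral_L2_zero// oppr0.
Defined.

Definition H01_zero : H01.
Proof.
refine (@MkH01 H1_zero _) => e e0; exists (cst 0); first exact: test_function0.
have N0 : L2norm (fun x => L2_zero x - cst 0 x) = 0%E.
  rewrite -L2norm_cst0; congr (L2norm _).
  by apply/funext => x; rewrite subr0.
by split=> [|i]; rewrite ?partial_cst /= N0 lte_fin.
Defined.

(* [g_sigma_algebraType] requires a pointed type. *)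
HB.instance Definition _ := gen_eqMixin L2.
HB.instance Definition _ := gen_choiceMixin L2.
HB.instance Definition _ := isPointed.Build L2 L2_zero.
HB.instance Definition _ := gen_eqMixin Linfty_pos.
HB.instance Definition _ := gen_choiceMixin Linfty_pos.
HB.instance Definition _ :=
  isPointed.Build Linfty_pos (LinftyPos Linfty_one_gt0).
HB.instance Definition _ := gen_eqMixin H01.
HB.instance Definition _ := gen_choiceMixin H01.
HB.instance Definition _ := isPointed.Build H01 H01_zero.

(** * The elliptic diffusion problem *)

Definition data : Type := (Linfty_pos * L2)%type.

HB.instance Definition _ := Pointed.on data.

Definition data_dist (z w : data) : R :=
  fine (Linfty_norm (fun x => ln (z.1 x) - ln (w.1 x))) +
  fine (L2norm (fun x => z.2 x - w.2 x)).

Definition bounded_data (r : R) : set data :=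
  [set z : data | (Linfty_norm (fun x => ln (z.1 x)) <= r%:E)%E /\
                  (L2norm z.2 <= r%:E)%E].

Definition eucl_norm (g : 'I_d -> R) : R := Num.sqrt (\sum_i g i ^+ 2).

Definition H01_dist (u v : H01) : R :=
  fine (L2norm (fun x => eucl_norm (fun i => H1_grad u i x - H1_grad v i x))).

(* Any admissible constant, in particular the optimal one.  Nonnegativity is
   automatic as H_0^1(D) is not trivial. *)
Definition poincare_constant (c : R) :=
  0 <= c /\
  forall v : H01,
    (L2norm v <= c%:E * L2norm (fun x => eucl_norm (H1_grad v ^~ x)))%E.

Definition weak_solution (a : Linfty_pos) (f : L2) (u : H01) :=
  forall v : H01,
    \int[lebesgue_on]_x (a x * \sum_i H1_grad u i x * H1_grad v i x) =
    \int[lebesgue_on]_x (f x * v x).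

(* By the Lax-Milgram theorem there is exactly one such operator. *)
Definition solution_operator (S : data -> H01) :=
  forall (a : Linfty_pos) (f : L2), weak_solution a f (S (a, f)).

End spaces.
Arguments data_dist {R d} D.
Arguments H01_dist {R d} D.
Arguments bounded_data {R d} D.

(* Main.v *)
Require Import Defs.
From HB Require Import structures.
From mathcomp Require Import all_boot all_order all_algebra.
From mathcomp Require Import all_classical all_reals all_analysis.
From mathcomp Require Import measurable_realfun ess_sup_inf ring lra.
Import Order.TTheory GRing.Theory Num.Theory.
Import numFieldNormedType.Exports.
Local Open Scope classical_set_scope.
Local Open Scope ring_scope.

Set Implicit Arguments.
Unset Strict Implicit.
Unset Printing Implicit Defensive.

(** Pushing a coupling of P and Q forward by S x S yields a coupling of the two
    image measures, and if S is L-Lipschitz on a set that carries P and Q, the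
    transport cost grows at most by the factor L.  Hence the theorem follows
    from a Lipschitz estimate for S on bounded data, with
    L = c (1 + r) exp(3r), and from the continuity of S, which makes S and
    S x S Borel measurable ([wasserstein_pushforward],
    [wasserstein_space_pushforward]).  The factor can be taken out of the
    infimum over couplings only if L > 0.  When L = 0, all of the bounded data
    are mapped to points at distance 0 from one another, which no Borel set can
    separate, and a Dirac mass is a coupling of cost 0
    ([wasserstein_degenerate]).

    For the Lipschitz estimate ([solution_lipschitz]), let u1 and u2 solve the
    problems with data (a1, f1) and (a2, f2), and let w = u1 - u2.  Subtracting
    the two weak formulations tested with w gives
      (a1 grad w, grad w) = (f1 - f2, w) - ((a1 - a2) grad u2, grad w).
    By Cauchy-Schwarz, the Poincare inequality and exp(-r) <= a1,
      exp(-r) |grad w| <= c |f1 - f2| + |a1 - a2|_oo |grad u2|,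
    while testing the second problem with u2 itself gives
    |grad u2| <= c r exp(r).  Finally |a1 - a2| <= exp(r) |log a1 - log a2|,
    because both logarithms are at most r.

    Testing with w requires w to be in H_0^1(D): the weak gradient and the
    approximation by test functions both pass to differences ([H01_sub]).

    Every z is in the interior of some set of bounded data, as the logarithm of
    a coefficient is essentially bounded, so that the local Lipschitz estimate
    makes S continuous on the whole data space
    ([solution_operator_continuous]). *)

(** * Square integrable vector fields *)

Section vector_fields.
Context {d} {T : measurableType d} {R : realType}.
Variable mu : {measure set T -> \bar R}.
Variable I : finType.
Implicit Types (g h : I -> T -> R) (f w : T -> R).
Local Notation L2fun := (Lfun mu 2%:E).

Definition sq_int_field g := forall i, g i \in L2fun.

Definition inner g h : R := \int[mu]_x \sum_i g i x * h i x.

Definition l2norm g : R := Num.sqrt (inner g g).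

Lemma Lfun_measurable (q : \bar R) f : f \in Lfun mu q -> measurable_fun setT f.
Proof. by rewrite inE => /andP[/[!inE]]. Qed.

Lemma Lfun2D f1 f2 : f1 \in L2fun -> f2 \in L2fun ->
  (fun x => f1 x + f2 x) \in L2fun.
Proof. by move=> h1 h2; exact: (Lfun_addr_closed mu (lee1n 2)).2 _ _ h1 h2. Qed.

Lemma Lfun2Z a f : f \in L2fun -> (fun x => a * f x) \in L2fun.
Proof.
have [p0 pZ] := Lfun_submod_closed mu (lee1n 2) => fL.
have -> : (fun x => a * f x) = a *: f + 0.
  by apply/funext => x; rewrite /= addr0.
exact: pZ.
Qed.

Lemma Lfun2B f1 f2 : f1 \in L2fun -> f2 \in L2fun ->
  (fun x => f1 x - f2 x) \in L2fun.
Proof.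
move=> h1 h2.
have -> : (fun x => f1 x - f2 x) = (fun x => f1 x + -1 * f2 x).
  by apply/funext => x; rewrite mulN1r.
by apply: Lfun2D => //; exact: Lfun2Z.
Qed.

Lemma fieldD g h : sq_int_field g -> sq_int_field h ->
  sq_int_field (fun i x => g i x + h i x).
Proof. by move=> gL hL i; exact: Lfun2D. Qed.

Lemma fieldB g h : sq_int_field g -> sq_int_field h ->
  sq_int_field (fun i x => g i x - h i x).
Proof. by move=> gL hL i; exact: Lfun2B. Qed.

Lemma fieldZ a g : sq_int_field g -> sq_int_field (fun i x => a * g i x).
Proof. by move=> gL i; exact: Lfun2Z. Qed.

Lemma measurable_inner g h : sq_int_field g -> sq_int_field h ->
  measurable_fun setT (fun x => \sum_i g i x * h i x).
Proof.
move=> gL hL.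
apply: (@measurable_sum _ _ _ _ _ _ (fun i x => g i x * h i x)) => i.
by apply: measurable_funM; apply: Lfun_measurable.
Qed.

Lemma integrable_inner g h : sq_int_field g -> sq_int_field h ->
  mu.-integrable setT (EFin \o (fun x => \sum_i g i x * h i x)).
Proof.
move=> gL hL.
have := @integrable_sum _ _ _ mu setT measurableT _ (index_enum I) xpredT
  (fun i x => (g i x * h i x)%:E).
have -> : (EFin \o (fun x => \sum_i g i x * h i x)) =
   (fun x => \sum_i (g i x * h i x)%:E)%E.
  by apply/funext => x /=; rewrite sumEFin.
by apply => i _; apply/Lfun1_integrable/Lfun2_mul_Lfun1.
Qed.

Lemma innerC g h : inner g h = inner h g.
Proof.
by apply: eq_Rintegral => x _; apply: eq_bigr => i _; rewrite mulrC.
Qed.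

Lemma innerDl g1 g2 h :
  sq_int_field g1 -> sq_int_field g2 -> sq_int_field h ->
  inner (fun i x => g1 i x + g2 i x) h = inner g1 h + inner g2 h.
Proof.
move=> g1L g2L hL; rewrite -RintegralD//; [|exact: integrable_inner..].
apply: eq_Rintegral => x _; rewrite -big_split/=.
by apply: eq_bigr => i _; rewrite mulrDl.
Qed.

Lemma innerZl a g h : sq_int_field g -> sq_int_field h ->
  inner (fun i x => a * g i x) h = a * inner g h.
Proof.
move=> gL hL; rewrite -RintegralZl//; last exact: integrable_inner.
apply: eq_Rintegral => x _; rewrite mulr_sumr.
by apply: eq_bigr => i _; rewrite mulrA.
Qed.

Lemma innerBl g1 g2 h :
  sq_int_field g1 -> sq_int_field g2 -> sq_int_field h ->
  inner (fun i x => g1 i x - g2 i x) h = inner g1 h - inner g2 h.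
Proof.
move=> g1L g2L hL; rewrite -RintegralB//; [|exact: integrable_inner..].
apply: eq_Rintegral => x _; rewrite -sumrB.
by apply: eq_bigr => i _; rewrite mulrBl.
Qed.

Lemma inner_ge0 g : 0 <= inner g g.
Proof.
by apply: Rintegral_ge0 => x _; apply: sumr_ge0 => i _; rewrite -expr2 sqr_ge0.
Qed.

Lemma l2norm_ge0 g : 0 <= l2norm g.
Proof. exact: sqrtr_ge0. Qed.

Lemma sqr_l2norm g : l2norm g ^+ 2 = inner g g.
Proof. by rewrite sqr_sqrtr// inner_ge0. Qed.

Lemma inner_line g h t : sq_int_field g -> sq_int_field h ->
  inner (fun i x => g i x + t * h i x) (fun i x => g i x + t * h i x) =
  inner g g + t * inner g h *+ 2 + t ^+ 2 * inner h h.
Proof.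
move=> gL hL; have thL := fieldZ t hL; have gthL := fieldD gL thL.
rewrite innerDl// innerZl// (innerC g (fun _ _ => _)) (innerC h (fun _ _ => _)).
rewrite !innerDl// !innerZl// (innerC h g); ring.
Qed.

(** The discriminant of a quadratic polynomial without sign change; the leading
    coefficient may vanish. *)
Lemma nonneg_quadratic (a b c : R) : 0 <= c ->
  (forall t, 0 <= a + t * b *+ 2 + t ^+ 2 * c) -> b ^+ 2 <= a * c.
Proof.
rewrite le_eqVlt => /predU1P[<-|c0] h.
  have [->|b0] := eqVneq b 0; first by rewrite mulr0 expr0n.
  (* the value of t at which the affine function a + 2tb equals -1 *)
  have := h (- (a + 1) / (b *+ 2)).
  have -> : a + - (a + 1) / (b *+ 2) * b *+ 2 + (- (a + 1) / (b *+ 2)) ^+ 2 * 0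
    = -1 by field.
  by rewrite oppr_ge0 ler10.
(* the minimizer of the parabola *)
have := h (- b / c).
have -> : a + - b / c * b *+ 2 + (- b / c) ^+ 2 * c = (a * c - b ^+ 2) / c.
  by field; rewrite gt_eqF.
by rewrite pmulr_lge0 ?invr_gt0// subr_ge0.
Qed.

(** Cauchy-Schwarz, from the nonnegativity of |g + t h|^2 for all t *)
Lemma inner_le g h : sq_int_field g -> sq_int_field h ->
  `|inner g h| <= l2norm g * l2norm h.
Proof.
move=> gL hL; rewrite -(@ler_pXn2r _ 2)// ?nnegrE ?mulr_ge0 ?l2norm_ge0//.
rewrite real_normK ?num_real// exprMn !sqr_l2norm.
apply: nonneg_quadratic; first exact: inner_ge0.
by move=> t; rewrite -inner_line// inner_ge0.
Qed.

Lemma l2normD g h : sq_int_field g -> sq_int_field h ->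
  l2norm (fun i x => g i x + h i x) <= l2norm g + l2norm h.
Proof.
move=> gL hL; rewrite -(@ler_pXn2r _ 2)// ?nnegrE ?addr_ge0 ?l2norm_ge0//.
have -> : (fun i x => g i x + h i x) = (fun i x => g i x + 1 * h i x).
  by apply/funext => i; apply/funext => x; rewrite mul1r.
rewrite sqr_l2norm inner_line// sqrrD !sqr_l2norm expr1n !mul1r.
by rewrite lerD2r lerD2l lerMn2r/= (le_trans (ler_norm _))// inner_le.
Qed.

Lemma l2norm_sub_sym g h :
  l2norm (fun i x => g i x - h i x) = l2norm (fun i x => h i x - g i x).
Proof.
congr Num.sqrt; apply: eq_Rintegral => x _; apply: eq_bigr => i _; ring.
Qed.

Lemma l2norm_triangle g h k :
  sq_int_field g -> sq_int_field h -> sq_int_field k ->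
  l2norm (fun i x => g i x - k i x) <=
  l2norm (fun i x => g i x - h i x) + l2norm (fun i x => h i x - k i x).
Proof.
move=> gL hL kL; have := l2normD (fieldB gL hL) (fieldB hL kL).
rewrite [X in l2norm X <= _ -> _](_ : _ = fun i x => g i x - k i x)//.
by apply/funext => i; apply/funext => x; ring.
Qed.

Lemma l2norm_le_sub g h : sq_int_field g -> sq_int_field h ->
  l2norm g <= l2norm (fun i x => g i x - h i x) + l2norm h.
Proof.
move=> gL hL; have := l2normD (fieldB gL hL) hL.
rewrite [X in l2norm X <= _ -> _](_ : _ = g)//.
by apply/funext => i; apply/funext => x; rewrite subrK.
Qed.

Lemma l2normB g h : sq_int_field g -> sq_int_field h ->
  l2norm (fun i x => g i x - h i x) <= l2norm g + l2norm h.
Proof.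
move=> gL hL; have := l2norm_le_sub (fieldB gL hL) gL.
rewrite [X in _ <= l2norm X + _ -> _](_ : _ = fun i x => 0 - h i x); last first.
  by apply/funext => i; apply/funext => x; ring.
rewrite addrC [in X in _ <= _ + X -> _]/l2norm (_ : inner _ _ = inner h h)//.
by apply: eq_Rintegral => x _; apply: eq_bigr => i _; ring.
Qed.

Lemma eq_inner g1 g2 h1 h2 : sq_int_field g1 -> sq_int_field g2 ->
  sq_int_field h1 -> sq_int_field h2 ->
  (forall i, \forall x \ae mu, g1 i x = g2 i x) ->
  (forall i, \forall x \ae mu, h1 i x = h2 i x) ->
  inner g1 h1 = inner g2 h2.
Proof.
move=> g1L g2L h1L h2L g12 h12.
rewrite /inner /Rintegral; congr fine; apply: ae_eq_integral => //.
- by apply/measurable_EFinP; exact: measurable_inner.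
- by apply/measurable_EFinP; exact: measurable_inner.
have : \forall x \ae mu, forall i, g1 i x = g2 i x /\ h1 i x = h2 i x.
  by apply: filter_forall => i; apply: filterI; [exact: g12|exact: h12].
apply: filterS => x gh _ /=.
by congr EFin; apply: eq_bigr => i _; have [-> ->] := gh i.
Qed.

Lemma Lfun2_ae_le f1 f2 : measurable_fun setT f1 -> f2 \in L2fun ->
  (\forall x \ae mu, `|f1 x| <= `|f2 x|) -> f1 \in L2fun.
Proof.
move=> mf1 f2L f12; have mf2 := Lfun_measurable f2L.
move: f2L; rewrite !inE => /andP[_]; rewrite inE/= /finite_norm => f2L.
apply/andP; split; rewrite !inE//=.
rewrite /finite_norm; apply: le_lt_trans f2L.
rewrite unlock; apply: gt0_ler_poweR => //.
- by rewrite in_itv/= leey integral_ge0// => x _; rewrite poweR_ge0.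
- by rewrite in_itv/= leey integral_ge0// => x _; rewrite poweR_ge0.
have m f : measurable_fun setT f ->
    measurable_fun setT (fun x => (`|(EFin \o f) x| `^ 2)%E).
  move=> mf; apply: (measurableT_comp (measurable_poweR _)) => //.
  by apply: measurableT_comp => //; exact/measurable_EFinP.
apply: ae_ge0_le_integral => //; [|exact: m| |exact: m|].
- by move=> x _; rewrite poweR_ge0.
- by move=> x _; rewrite poweR_ge0.
by apply: filterS f12 => x h _ /=; rewrite lee_fin ge0_ler_powR// nnegrE.
Qed.

Lemma ae_le_Rintegral f1 f2 : mu.-integrable setT (EFin \o f1) ->
  mu.-integrable setT (EFin \o f2) -> (\forall x \ae mu, f1 x <= f2 x) ->
  \int[mu]_x f1 x <= \int[mu]_x f2 x.
Proof.
move=> i1 i2 f12; rewrite -subr_ge0 -RintegralB//.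
have -> : \int[mu]_x (f2 x - f1 x) = \int[mu]_x `|f2 x - f1 x|.
  have m1 : measurable_fun setT (EFin \o f1) by case/integrableP: i1.
  have m2 : measurable_fun setT (EFin \o f2) by case/integrableP: i2.
  have m : measurable_fun setT (fun x => f2 x - f1 x).
    by apply: measurable_funB; exact/measurable_EFinP.
  rewrite /Rintegral; congr fine; apply: ae_eq_integral => //.
  - by apply/measurable_EFinP.
  - by apply/measurable_EFinP; exact: measurableT_comp.
  by apply: filterS f12 => x h _ /=; rewrite ger0_norm// subr_ge0.
by apply: Rintegral_ge0.
Qed.

Section weight.
Variables (w : T -> R) (M : R).
Hypotheses (mw : measurable_fun setT w) (wM : \forall x \ae mu, `|w x| <= M).

Lemma field_weight g : sq_int_field g -> sq_int_field (fun i x => w x * g i x).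
Proof.
move=> gL i; apply: (@Lfun2_ae_le _ (fun x => M * g i x)).
- by apply: measurable_funM => //; exact: Lfun_measurable.
- exact: Lfun2Z.
apply: filterS wM => x wx; rewrite !normrM ler_wpM2r//.
by rewrite (le_trans wx)// ler_norm.
Qed.

Lemma l2norm_weight g : 0 <= M -> sq_int_field g ->
  l2norm (fun i x => w x * g i x) <= M * l2norm g.
Proof.
move=> M0 gL; have wgL := field_weight gL.
rewrite -(@ler_pXn2r _ 2)// ?nnegrE ?mulr_ge0 ?l2norm_ge0//.
rewrite exprMn !sqr_l2norm.
have MgL := fieldZ M gL.
rewrite expr2 -mulrA -innerZl// [in leRHS]innerC -innerZl//.
apply: ae_le_Rintegral; [exact: integrable_inner..|].
apply: filterS wM => x wx; apply: ler_sum => i _.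
have -> : w x * g i x * (w x * g i x) = w x ^+ 2 * g i x ^+ 2 by ring.
have -> : M * g i x * (M * g i x) = M ^+ 2 * g i x ^+ 2 by ring.
rewrite ler_wpM2r ?sqr_ge0//.
by rewrite -real_normK ?num_real// ler_pXn2r// nnegrE.
Qed.

Lemma inner_weight_ge m g : sq_int_field g -> (\forall x \ae mu, m <= w x) ->
  m * inner g g <= inner (fun i x => w x * g i x) g.
Proof.
move=> gL mw'; rewrite -innerZl//.
apply: ae_le_Rintegral.
- by apply: integrable_inner => //; exact: fieldZ.
- by apply: integrable_inner => //; exact: field_weight.
apply: filterS mw' => x wx; apply: ler_sum => i _.
by rewrite -!mulrA ler_wpM2r// -expr2 sqr_ge0.
Qed.

End weight.

Lemma Lnorm_field g : sq_int_field g ->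
  ('N[mu]_2%:E [EFin \o (fun x => Num.sqrt (\sum_i g i x ^+ 2))%R] =
   (l2norm g)%:E)%E.
Proof.
move=> gL; rewrite unlock.
pose n x := Num.sqrt (\sum_i g i x ^+ 2).
rewrite -/n; have -> : (\int[mu]_x (`|(EFin \o n) x| `^ 2) = (inner g g)%:E)%E.
  rewrite /inner /Rintegral fineK; last first.
    by apply: integrable_fin_num => //; exact: integrable_inner.
  apply: eq_integral => x _; rewrite /n/=.
  rewrite ger0_norm ?sqrtr_ge0// powR_mulrn ?sqrtr_ge0//.
  rewrite sqr_sqrtr; last by apply: sumr_ge0 => i _; exact: sqr_ge0.
  by congr EFin; apply: eq_bigr => i _; rewrite expr2.
by rewrite poweR12_sqrt ?lee_fin ?inner_ge0.
Qed.

End vector_fields.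

Section scalar.
Context {d} {T : measurableType d} {R : realType}.
Variable mu : {measure set T -> \bar R}.
Implicit Types f g : T -> R.

(** A function is a field with one component: the theory of fields then covers
    both the right-hand sides of the equation and the gradients. *)
Definition scalar_field f : 'I_1 -> T -> R := fun _ => f.

Lemma sq_int_scalar f : f \in Lfun mu 2%:E -> sq_int_field mu (scalar_field f).
Proof. by move=> fL i. Qed.

Lemma inner_scalar f g :
  inner mu (scalar_field f) (scalar_field g) = \int[mu]_x (f x * g x).
Proof. by apply: eq_Rintegral => x _; rewrite big_ord1. Qed.

Lemma Lnorm_scalar f : f \in Lfun mu 2%:E ->
  ('N[mu]_2%:E [EFin \o f] = (l2norm mu (scalar_field f))%:E)%E.
Proof.
move=> fL; rewrite -Lnorm_field// -Lnorm_abse; congr Lnorm.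
by apply/funext => x /=; rewrite big_ord1 sqrtr_sqr.
Qed.

End scalar.

(** * Essentially bounded functions *)

Section essentially_bounded.
Context {d} {T : measurableType d} {R : realType}.
Variable mu : {measure set T -> \bar R}.
Implicit Types (f : T -> R) (M : R).
Local Notation Ninfty f := ('N[mu]_+oo [EFin \o f])%E.

(** Also true when [mu] is zero: the norm is then 0 by convention, and every
    property holds almost everywhere. *)
Lemma Lnorm_infty_le f M : 0 <= M ->
  (Ninfty f <= M%:E)%E <-> \forall x \ae mu, `|f x| <= M.
Proof.
move=> M0; rewrite unlock; case: ifPn => [mu0|].
  split.
    by move/ess_supP; apply: filterS => x /=; rewrite lee_fin.
  by move=> h; apply/ess_supP; apply: filterS h => x /=; rewrite lee_fin.
rewrite -leNgt => mu0; split => _; last by rewrite lee_fin.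
exists setT; split => //; apply/eqP; rewrite eq_le mu0/=; exact: measure_ge0.
Qed.

Lemma fine_Lnorm_infty f M : (\forall x \ae mu, `|f x| <= M) ->
  (Ninfty f = (fine (Ninfty f))%:E)%E.
Proof.
move=> fM; rewrite fineK// ge0_fin_numE ?Lnorm_ge0//.
apply: (@le_lt_trans _ _ `|M|%:E%E); last exact: ltry.
apply/Lnorm_infty_le => //.
by apply: filterS fM => x /le_trans; apply; exact: ler_norm.
Qed.

Lemma ae_le_Lnorm_infty f M : (\forall x \ae mu, `|f x| <= M) ->
  \forall x \ae mu, `|f x| <= fine (Ninfty f)%E.
Proof.
move=> fM; apply/Lnorm_infty_le; first by rewrite fine_ge0// Lnorm_ge0.
by rewrite -(fine_Lnorm_infty fM).
Qed.

Lemma fine_Lnorm_infty_le f M : 0 <= M -> (\forall x \ae mu, `|f x| <= M) ->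
  fine (Ninfty f)%E <= M.
Proof.
by move=> M0 fM; rewrite -lee_fin -(fine_Lnorm_infty fM); apply/Lnorm_infty_le.
Qed.

End essentially_bounded.

Lemma ae_sub {d} {T : measurableType d} {R : realType}
    (mu : {measure set T -> \bar R}) (A B : set T) : (forall x, A x -> B x) ->
  (\forall x \ae mu, A x) -> \forall x \ae mu, B x.
Proof. by move=> AB; exact: filterS. Qed.

Lemma ae_and {d} {T : measurableType d} {R : realType}
    (mu : {measure set T -> \bar R}) (A B : set T) : (\forall x \ae mu, A x) ->
  (\forall x \ae mu, B x) -> \forall x \ae mu, A x /\ B x.
Proof. exact: filterI. Qed.

(** * Lipschitz maps and Wasserstein distances *)

(** Without separation axiom, since the distance on H_0^1(D) only sees the
    gradients. *)
Definition pseudometric {R : realType} {X : Type} (dist : X -> X -> R) :=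
  [/\ forall x, dist x x = 0, forall x y, dist x y = dist y x &
      forall x y z, dist x z <= dist x y + dist y z].

Definition dist_continuous {R : realType} {X Y : Type}
    (distX : X -> X -> R) (distY : Y -> Y -> R) (F : X -> Y) :=
  forall x e, 0 < e -> exists2 k, 0 < k &
    forall y, distX x y < k -> distY (F x) (F y) < e.

Section borel_measurability.
Context {R : realType} {X Y : pointedType}.
Variables (distX : X -> X -> R) (distY : Y -> Y -> R).

Lemma dist_open_measurable (U : set X) :
  dist_open distX U -> measurable (U : set (dist_borel distX)).
Proof. exact: sub_sigma_algebra. Qed.

Lemma dist_continuous_measurable (F : X -> Y) : dist_continuous distX distY F ->
  measurable_fun setT (F : dist_borel distX -> dist_borel distY).
Proof.
move=> cF; apply: (@measurability _ _ (dist_borel distX) (dist_borel distY)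
  setT F (dist_open distY)) => //.
move=> _ [V oV <-]; rewrite setTI.
apply: dist_open_measurable => x /oV[e e0 eV].
by have [k k0 kF] := cF x e e0; exists k => // y /kF; exact: eV.
Qed.

Lemma dist_continuous_measurable_real (f : X -> R) :
  dist_continuous distX (fun x y => `|x - y|) f ->
  measurable_fun setT (f : dist_borel distX -> R).
Proof.
move=> cf; apply: (measurability _ (RGenOInfty.measurableE R)).
move=> _ [_ [a ->] <-]; rewrite setTI; apply: dist_open_measurable => x /=.
rewrite in_itv/= andbT -subr_gt0 => /(cf x)[k k0 kf]; exists k => // y /kf.
rewrite /= in_itv/= andbT ltr_distl; lra.
Qed.

(** Open sets do not separate points at distance 0, and the sets that do not
    separate a given pair of points form a sigma-algebra. *)
Lemma borel_indiscernible (x y : X) (A : set (dist_borel distX)) :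
  distX x y = 0 -> distX y x = 0 -> measurable A -> A x <-> A y.
Proof.
move=> xy yx; pose G := [set A : set X | A x <-> A y].
apply: (@smallest_sub _ (sigma_algebra setT) (dist_open distX) G).
  split; first by [].
  - by move=> C CE; split => -[_ nC]; split => // /CE.
  - by move=> C CE; split => -[n _ Cn]; exists n => //; exact/(CE n).
by move=> V oV; split => /oV[e e0]; apply; rewrite ?xy ?yx.
Qed.

End borel_measurability.

Section distance_measurability.
Context {R : realType} {X : pointedType} (distX : X -> X -> R).

Lemma dist_ge0 : pseudometric distX -> forall x y, 0 <= distX x y.
Proof.
move=> [d0 ds dt] x y; have := dt x y x; rewrite d0 (ds y x); lra.
Qed.

Lemma measurable_dist_fst :
  measurable_fun setT (fst : dist_borel (prod_dist distX) -> dist_borel distX).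
Proof.
apply: dist_continuous_measurable => z e e0.
by exists e => // w; rewrite /prod_dist gt_max => /andP[].
Qed.

Lemma measurable_dist_snd :
  measurable_fun setT (snd : dist_borel (prod_dist distX) -> dist_borel distX).
Proof.
apply: dist_continuous_measurable => z e e0.
by exists e => // w; rewrite /prod_dist gt_max => /andP[].
Qed.

(** The distance is 2-Lipschitz for the maximum distance on the product. *)
Lemma measurable_dist_prod : pseudometric distX ->
  measurable_fun setT
    ((fun z => distX z.1 z.2) : dist_borel (prod_dist distX) -> R).
Proof.
move=> [d0 ds dt]; apply: dist_continuous_measurable_real => z e e0.
exists (e / 2); first by rewrite divr_gt0.
move=> w; rewrite /prod_dist gt_max => /andP[zw1 zw2]; rewrite ltr_distl.
have := dt z.1 w.1 z.2; have := dt w.1 w.2 z.2.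
have := dt w.1 z.1 w.2; have := dt z.1 z.2 w.2.
rewrite (ds w.1 z.1) (ds w.2 z.2); lra.
Qed.

Lemma measurable_dist_to (x0 : X) : pseudometric distX ->
  measurable_fun setT ((fun x => distX x x0) : dist_borel distX -> R).
Proof.
move=> [d0 ds dt]; apply: dist_continuous_measurable_real => z e e0.
exists e => // w zw; rewrite ltr_distl.
have := dt z w x0; have := dt w z x0; rewrite (ds w z); lra.
Qed.

End distance_measurability.

Section lipschitz_pushforward.
Context {R : realType} {X Y : pointedType}.
Variables (distX : X -> X -> R) (distY : Y -> Y -> R).
Hypotheses (pX : pseudometric distX) (pY : pseudometric distY).
Variable F : {mfun dist_borel distX >-> dist_borel distY}.
Hypothesis cF : dist_continuous distX distY F.
Variables (B : set X) (L : R).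
Hypothesis lipF : forall z w, B z -> B w -> distY (F z) (F w) <= L * distX z w.
Implicit Types P Q : probability (dist_borel distX) R.
Variable p : R.
Hypothesis p1 : 1 <= p.

Let p0 : 0 < p. Proof. exact: lt_le_trans p1. Qed.

Lemma ae_probability_nonempty P : (\forall x \ae P, B x) -> exists x, B x.
Proof.
move=> [A [mA PA BA]]; apply: contrapT => /forallNP nB.
have : P setT = 0%E.
  rewrite -PA; congr (P _); apply/seteqP; split => // x _.
  by apply: BA; exact: nB.
by rewrite probability_setT => /eqP; rewrite onee_eq0.
Qed.

Let measurable_pow d (T : measurableType d) (f : T -> R) :
  measurable_fun setT f -> measurable_fun setT (fun x => (f x `^ p)%:E).
Proof.
move=> mf; apply/measurable_EFinP.
by apply: (measurableT_comp (measurable_powR _)).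
Qed.

Lemma wasserstein_space_pushforward P M : (\forall x \ae P, B x) ->
  (forall z w, B z -> B w -> distX z w <= M) -> 0 <= L ->
  wasserstein_space p (distribution P F).
Proof.
move=> PB BM L0; have [z0 Bz0] := ae_probability_nonempty PB.
have mY : measurable_fun setT (fun y : dist_borel distY =>
    (distY y (F z0) `^ p)%:E).
  by apply: measurable_pow; exact: measurable_dist_to.
exists (F z0); rewrite (ge0_integral_distribution _ mY)/=; last first.
  by move=> y; rewrite lee_fin powR_ge0.
have M0 : 0 <= M by apply: le_trans (BM _ _ Bz0 Bz0); exact: dist_ge0.
apply: (@le_lt_trans _ _ (\int[P]_x (cst ((L * M) `^ p)%:E x))%E); last first.
  by rewrite integral_cst//= probability_setT mule1 ltry.
apply: ae_ge0_le_integral => //.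
- by move=> x _; rewrite lee_fin powR_ge0.
- apply: (measurable_pow (f := fun x => distY (F x) (F z0))).
  exact: (measurableT_comp (measurable_dist_to (F z0) pY) (measurable_funPT F)).
- by move=> x _; rewrite lee_fin powR_ge0.
apply: (ae_sub _ PB) => x Bx _; rewrite lee_fin.
apply: ge0_ler_powR; rewrite ?nnegrE ?mulr_ge0 ?(ltW p0)//.
  exact: dist_ge0.
by apply: (le_trans (lipF Bx Bz0)); rewrite ler_wpM2l// BM.
Qed.

Definition prod_map (z : X * X) : Y * Y := (F z.1, F z.2).

(** Measurability of [F] alone would not suffice, as the product carries the
    Borel sigma-algebra of its topology, not the product sigma-algebra. *)
Lemma measurable_prod_map : measurable_fun setT
  (prod_map : dist_borel (prod_dist distX) -> dist_borel (prod_dist distY)).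
Proof.
apply: dist_continuous_measurable => -[x y] e e0.
have [k k0 kF] := cF x e0; have [l l0 lF] := cF y e0.
exists (Num.min k l); first by rewrite lt_min k0.
move=> [x' y']; rewrite /prod_dist/= gt_max !lt_min.
move=> /andP[/andP[? _] /andP[_ ?]].
by rewrite gt_max kF// lF.
Qed.

Definition prod_mfun :=
  mfun_Sub (rT := dist_borel (prod_dist distY)) (mem_set measurable_prod_map).

Lemma ae_coupling P Q (pi : probability (dist_borel (prod_dist distX)) R) :
  coupling P Q pi -> (\forall x \ae P, B x) -> (\forall x \ae Q, B x) ->
  \forall z \ae pi, B z.1 /\ B z.2.
Proof.
move=> cpi [A [mA PA BA]] [A' [mA' QA' BA']].
apply: ae_and.
  exists (fst @^-1` A); split.
  - by rewrite -[X in measurable X]setTI; exact: measurable_dist_fst.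
  - exact: etrans (cpi _ mA).1 PA.
  - by move=> z /= Bz; exact: BA.
exists (snd @^-1` A'); split.
- by rewrite -[X in measurable X]setTI; exact: measurable_dist_snd.
- exact: etrans (cpi _ mA').2 QA'.
- by move=> z /= Bz; exact: BA'.
Qed.

Lemma transport_cost_pushforward P Q
    (pi : probability (dist_borel (prod_dist distX)) R) :
  coupling P Q pi -> (\forall x \ae P, B x) -> (\forall x \ae Q, B x) ->
  0 <= L ->
  (poweR (\int[distribution pi prod_mfun]_z ((distY z.1 z.2) `^ p)%:E) p^-1 <=
   L%:E * poweR (\int[pi]_z ((distX z.1 z.2) `^ p)%:E) p^-1)%E.
Proof.
move=> cpi PB QB L0.
have mX : measurable_fun setT (fun z : dist_borel (prod_dist distX) =>
    (distX z.1 z.2 `^ p)%:E).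
  by apply: measurable_pow; exact: measurable_dist_prod.
have mY : measurable_fun setT (fun z : dist_borel (prod_dist distY) =>
    (distY z.1 z.2 `^ p)%:E).
  by apply: measurable_pow; exact: measurable_dist_prod.
rewrite (ge0_integral_distribution _ mY)/=; last first.
  by move=> z; rewrite lee_fin powR_ge0.
(* the factor enters the integral as its p-th power *)
have -> : (L%:E = ((L `^ p)%:E `^ p^-1))%E.
  by rewrite poweR_EFin -powRrM mulfV ?gt_eqF// powRr1.
rewrite -poweRM ?lee_fin ?powR_ge0//; last first.
  by apply: integral_ge0 => z _; rewrite lee_fin powR_ge0.
rewrite -ge0_integralZl//; last 2 first.
- by move=> z _; rewrite lee_fin powR_ge0.
- by rewrite lee_fin powR_ge0.
apply: gt0_ler_poweR.
- by rewrite invr_ge0 ltW.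
- by rewrite in_itv/= leey integral_ge0// => z _; rewrite lee_fin powR_ge0.
- rewrite in_itv/= leey integral_ge0// => z _.
  by rewrite mule_ge0// lee_fin powR_ge0.
apply: ae_ge0_le_integral => //.
- by move=> z _; rewrite lee_fin powR_ge0.
- exact: (measurableT_comp mY (measurable_funPT prod_mfun)).
- by move=> z _; rewrite mule_ge0// lee_fin powR_ge0.
- exact: measurable_funeM.
apply: (ae_sub _ (ae_coupling cpi PB QB)) => -[z w] [Bz Bw] _ /=.
rewrite -EFinM lee_fin -powRM//; last exact: dist_ge0.
apply: ge0_ler_powR; rewrite ?nnegrE ?mulr_ge0 ?(ltW p0)//; last exact: lipF.
- exact: dist_ge0.
- exact: dist_ge0.
Qed.

Lemma coupling_pushforward P Q
    (pi : probability (dist_borel (prod_dist distX)) R) :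
  coupling P Q pi ->
  coupling (distribution P F) (distribution Q F) (distribution pi prod_mfun).
Proof.
move=> cpi A mA; apply: cpi.
by rewrite -[X in measurable X]setTI; exact: measurable_funPT.
Qed.

(** Up to distance 0, [F] is constant on [B], so that both image measures are
    the Dirac mass at one and the same point. *)
Lemma wasserstein_degenerate P Q : L = 0 ->
  (\forall x \ae P, B x) -> (\forall x \ae Q, B x) ->
  (wasserstein p (distribution P F) (distribution Q F) <= 0)%E.
Proof.
move=> L0 PB QB; have [z0 Bz0] := ae_probability_nonempty PB.
pose pi : probability (dist_borel (prod_dist distY)) R :=
  \d_((F z0, F z0) : dist_borel (prod_dist distY)).
have FB (A : set (dist_borel distY)) : measurable A ->
    forall z, B z -> A (F z) <-> A (F z0).
  have F0 z w : B z -> B w -> distY (F z) (F w) = 0.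
    move=> Bz Bw; apply/eqP; rewrite eq_le dist_ge0// andbT.
    by rewrite (le_trans (lipF Bz Bw))// L0 mul0r.
  move=> mA z Bz.
  exact: (borel_indiscernible (F0 _ _ Bz Bz0) (F0 _ _ Bz0 Bz) mA).
have law P' : (\forall x \ae P', B x) -> forall A : set (dist_borel distY),
    measurable A -> distribution P' F A = \d_(F z0) A.
  move=> [N [mN N0 BN]] A mA; rewrite diracE.
  have mFA : measurable (F @^-1` A).
    by rewrite -[X in measurable X]setTI; exact: measurable_funPT.
  case: (pselect (A (F z0))) => AF.
    rewrite mem_set// -(@probability_setT _ _ _ P'); apply/eqP.
    rewrite probability_setT /distribution /pushforward.
    rewrite -[X in P' X]setCK probability_setC; last exact: measurableC.
    rewrite (subset_measure0 _ mN _ N0) ?sube0//; first exact: measurableC.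
    move=> z /= nA; apply: BN => /= Bz; apply: nA.
    by apply/(FB _ mA).
  rewrite memNset//=; apply: (subset_measure0 mFA mN _ N0) => z /= Az.
  by apply: BN => /= Bz; apply: AF; apply/(FB _ mA _ Bz).
have cpi : coupling (distribution P F) (distribution Q F) pi.
  move=> A mA; split.
    exact: etrans (esym (law _ PB _ mA)).
  exact: etrans (esym (law _ QB _ mA)).
have -> : 0%E = (poweR (\int[pi]_z ((distY z.1 z.2) `^ p)%:E) p^-1)%E.
  have mY : measurable_fun setT (fun z : dist_borel (prod_dist distY) =>
      (distY z.1 z.2 `^ p)%:E).
    by apply: measurable_pow; exact: measurable_dist_prod.
  rewrite (integral_dirac _ _ mY)// diracT mul1e /=; have [-> _ _] := pY.
  by rewrite !powR0// ?invr_neq0// gt_eqF.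
by apply: ereal_inf_lbound; exists pi.
Qed.

(** If [L] is positive, the bound holds even when [P] and [Q] have no coupling,
    as the right-hand side is then infinite.  If [L] is zero, the right-hand
    side is 0 in any case, and a coupling of the image measures has to be
    exhibited. *)
Theorem wasserstein_pushforward P Q : 0 <= L ->
  (\forall x \ae P, B x) -> (\forall x \ae Q, B x) ->
  (wasserstein p (distribution P F) (distribution Q F) <=
   L%:E * wasserstein p P Q)%E.
Proof.
rewrite le_eqVlt => /predU1P[L0|L0] PB QB.
  by rewrite -L0 mul0e; exact: wasserstein_degenerate.
rewrite -lee_pdivrMl//; apply: le_ereal_inf_tmp => _ [pi cpi <-].
rewrite lee_pdivrMl//.
apply: le_trans (transport_cost_pushforward cpi PB QB (ltW L0)).
apply: ereal_inf_lbound; exists (distribution pi prod_mfun) => //.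
exact: coupling_pushforward.
Qed.

End lipschitz_pushforward.

(** * Square integrable functions on a domain *)

Section domain_functions.
Context {R : realType} {d : nat} (D : lipschitz_domain R d).
Local Notation mu := (lebesgue_on D).
Local Notation T := (rVborel R d).
Implicit Types f g : T -> R.

(** A bounded set lies in a box. *)
Lemma lebesgue_on_finite : (mu setT < +oo)%E.
Proof.
have [M [_ DM]] := domain_bounded D.
pose M' := `|M| + 1.
have DM' x : domain D x -> `|x| <= M'.
  by apply: DM; rewrite /M' ltr_pwDr// ler_norm.
rewrite /lebesgue_on /mrestr setTI.
apply: (@le_lt_trans _ _ (lebesgue_rV R d
    [set x : 'rV[R]_d | forall i, `[- M', M']%classic (x 0 i)])).
  apply: le_measure; rewrite ?inE.
  - exact: open_rVborel (domain_open D).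
  - rewrite (_ : [set x | _] = \bigcap_(i in [set: 'I_d])
        ((fun x : rVborel R d => x 0 i) @^-1` `[- M', M']%classic)); last first.
      by apply/seteqP; split => x /= h i => [_|]; exact: h.
    apply: fin_bigcap_measurable => // i _.
    rewrite -[X in measurable X]setTI.
    apply: (continuous_rVborel (f := fun x : 'rV[R]_d => x 0 i)) => //.
    by move=> x; exact: coord_continuous.
  move=> x Dx i /=; rewrite in_itv/= -ler_norml.
  apply: le_trans (DM' _ Dx); rewrite [leRHS]mx_normrE.
  exact: (le_bigmax _ (fun ij => `|x ij.1 ij.2|) (0, i)).
rewrite (lebesgue_rV_box (A := fun=> `[- M', M']%classic))//.
rewrite ltey_eq prode_fin_num// => i _.
by rewrite lebesgue_measure_itv/=; case: ifPn.
Qed.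

Lemma ae_domain : \forall x \ae mu, domain D x.
Proof.
exists (~` domain D); split => //.
  by apply: measurableC; exact: open_rVborel (domain_open D).
by rewrite /lebesgue_on /mrestr setICl measure0.
Qed.

Lemma Lfun2_cst (a : R) : (cst a : T -> R) \in Lfun mu 2%:E.
Proof.
have c1 : (cst 1 : T -> R) \in Lfun mu 2%:E.
  rewrite inE; apply/andP; split; rewrite inE//= /finite_norm.
  have -> : (EFin \o cst 1 : T -> \bar R) = cst 1%E by [].
  rewrite Lnorm_cst1 poweR_lty//; exact: lebesgue_on_finite.
have -> : (cst a : T -> R) = (fun x => a * cst 1 x).
  by apply/funext => x; rewrite /= mulr1.
exact: Lfun2Z.
Qed.

(** A continuous function is bounded on the compact set closure(D), and [D] has
    finite measure. *)
Lemma continuous_Lfun2 (f : 'rV[R]_d -> R) : continuous f ->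
  (f : T -> R) \in Lfun mu 2%:E.
Proof.
move=> cf.
have : compact (f @` closure (domain D)).
  apply: continuous_compact; first exact: continuous_subspaceT.
  have [M [_ DM]] := domain_bounded D.
  have cM : closed [set x : 'rV[R]_d | `|x| <= `|M| + 1].
    apply: (@preimage_closed 'rV[R]_d R (fun x => `|x|)
      [set r | r <= `|M| + 1]).
      by move=> x _; exact: norm_continuous.
    exact: closed_le.
  apply: (@subclosed_compact _ _ [set x | `|x| <= `|M| + 1]).
  - exact: closed_closure.
  - apply: bounded_closed_compact => //.
    exists (`|M| + 1); split; first exact: num_real.
    by move=> N MN x /= xM; rewrite (le_trans xM)// ltW.
  rewrite closureE; apply: smallest_sub => //.
  by apply: DM; rewrite ltr_pwDr// ler_norm.
move=> /compact_bounded[M [_ fM]].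
apply: (@Lfun2_ae_le _ _ _ _ _ (cst (`|M| + 1))).
- exact: continuous_rVborel.
- exact: Lfun2_cst.
apply: (ae_sub _ ae_domain) => x Dx /=; rewrite [leRHS]ger0_norm ?addr_ge0//.
apply: fM; first by rewrite ltr_pwDr// ler_norm.
by exists x => //; exact: subset_closure.
Qed.

Lemma L2_Lfun2 (f : L2 D) : (f : T -> R) \in Lfun mu 2%:E.
Proof.
rewrite inE; apply/andP; split; rewrite inE/=; first exact: measurable_class.
exact: Lebesgue_finite.
Qed.

Local Notation mfun_class := {mfun_ mu, T >-> measurableTypeR R}.

Definition mfun_class_of f (mf : measurable_fun setT f) : mfun_class :=
  (\pi_mfun_class (mfun_Sub (rT := measurableTypeR R) (mem_set mf)))%qT.

Lemma mfun_class_ofE f (mf : measurable_fun setT f) :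
  \forall x \ae mu, mfun_class_of mf x = f x.
Proof.
have /eqmodP/asboolP : (repr (mfun_class_of mf) =
    mfun_Sub (rT := measurableTypeR R) (mem_set mf) %[mod mfun_class])%qT.
  by rewrite reprK.
by apply: ae_sub => x; apply.
Qed.

Lemma mfun_class_of_finite f (mf : measurable_fun setT f) :
  f \in Lfun mu 2%:E -> finite_norm mu 2%:E (mfun_class_of mf).
Proof.
move=> fL; suff : (mfun_class_of mf : T -> R) \in Lfun mu 2%:E.
  by rewrite inE => /andP[_]; rewrite inE.
apply: Lfun2_ae_le fL _; first exact: measurable_class.
by apply: ae_sub (mfun_class_ofE mf) => x ->.
Qed.

Definition L2_of f (fL : f \in Lfun mu 2%:E) : L2 D :=
  let mf := Lfun_measurable fL in
  HB.pack_for (L2 D) (mfun_class_of mf)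
    (isFinLebesgue.Build _ _ _ mu 2%:E (lee1n 2) (mfun_class_of mf)
       (mfun_class_of_finite mf fL)).

Lemma L2_ofE f (fL : f \in Lfun mu 2%:E) : \forall x \ae mu, L2_of fL x = f x.
Proof. exact: mfun_class_ofE. Qed.

End domain_functions.

(** * Differences in the Sobolev space *)

Section test_functions.
Context {R : realType} {d : nat}.
Implicit Types f g : 'rV[R]_d -> R.

Lemma partialB i f g : (forall x, derivable f x (delta_mx 0 i)) ->
  (forall x, derivable g x (delta_mx 0 i)) ->
  partial i (fun x => f x - g x) = (fun x => partial i f x - partial i g x).
Proof. by move=> df dg; apply/funext => x; rewrite /partial deriveB. Qed.

Lemma is_CkB k f g : is_Ck k f -> is_Ck k g -> is_Ck k (fun x => f x - g x).
Proof.
elim: k f g => [|k IH] f g [cf hf] [cg hg].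
  by split => // x; apply: continuousB; [exact: cf|exact: cg].
split; first by move=> x; apply: continuousB; [exact: cf|exact: cg].
move=> i; have [[df kf] [dg kg]] := (hf i, hg i).
split; first by move=> x; apply: derivableB.
by rewrite partialB//; exact: IH.
Qed.

Lemma test_functionB D f g : test_function D f -> test_function D g ->
  test_function D (fun x => f x - g x).
Proof.
move=> [cf kf Df] [cg kg Dg].
have sub : closure [set x | f x - g x != 0] `<=`
    closure [set x | f x != 0] `|` closure [set x | g x != 0].
  rewrite -closureU; apply: closureS => x /= fg.
  case: (eqVneq (f x) 0) => [f0|]; [right|by left].
  by move: fg; rewrite f0 sub0r oppr_eq0.
split; first by move=> k; exact: is_CkB.
- apply: subclosed_compact sub; first exact: closed_closure.
  exact: compactU.
- by move=> x /sub[/Df|/Dg].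
Qed.

Lemma test_function_continuous D f : test_function D f -> continuous f.
Proof. by move=> [/(_ 0%N)[]]. Qed.

Lemma test_function_derivable D f i : test_function D f ->
  (forall x, derivable f x (delta_mx 0 i)) /\ continuous (partial i f).
Proof. by move=> [/(_ 1%N)[_ /(_ i)[? []]]]. Qed.

End test_functions.

Section sobolev_difference.
Context {R : realType} {d : nat} (D : lipschitz_domain R d).
Local Notation mu := (lebesgue_on D).
Local Notation T := (rVborel R d).

Lemma L2norm_scalar (f : T -> R) : f \in Lfun mu 2%:E ->
  L2norm D f = (l2norm mu (scalar_field f))%:E.
Proof. exact: Lnorm_scalar. Qed.

Definition L2_sub (f g : L2 D) : L2 D :=
  L2_of (Lfun2B (L2_Lfun2 f) (L2_Lfun2 g)).

Lemma L2_subE (f g : L2 D) : \forall x \ae mu, L2_sub f g x = f x - g x.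
Proof. exact: L2_ofE. Qed.

Lemma Rintegral_L2_sub (f g : L2 D) h : h \in Lfun mu 2%:E ->
  \int[mu]_x (L2_sub f g x * h x) =
  \int[mu]_x (f x * h x) - \int[mu]_x (g x * h x).
Proof.
move=> hL; have [fL gL] := (L2_Lfun2 f, L2_Lfun2 g).
rewrite -!inner_scalar -innerBl; [|exact: sq_int_scalar..].
have hS := sq_int_scalar hL; have fgL := Lfun2B fL gL.
apply: eq_inner => //.
- by move=> i; exact: L2_Lfun2.
- by move=> i; exact: L2_subE.
- by move=> i; apply: aeW.
Qed.

Lemma L2norm_sub_lt (f g : L2 D) phi psi e :
  phi \in Lfun mu 2%:E -> psi \in Lfun mu 2%:E ->
  (L2norm D (fun x => f x - phi x)%R < (e / 2)%:E)%E ->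
  (L2norm D (fun x => g x - psi x)%R < (e / 2)%:E)%E ->
  (L2norm D (fun x => L2_sub f g x - (phi x - psi x))%R < e%:E)%E.
Proof.
move=> pL sL; have [fL gL] := (L2_Lfun2 f, L2_Lfun2 g).
have [[fpL gsL] psL] := (Lfun2B fL pL, Lfun2B gL sL, Lfun2B pL sL).
have wL := Lfun2B (L2_Lfun2 (L2_sub f g)) psL.
rewrite !L2norm_scalar// !lte_fin => fp gs.
have fgL := Lfun2B fpL gsL.
have fgE : \forall x \ae mu,
    f x - phi x - (g x - psi x) = L2_sub f g x - (phi x - psi x).
  by apply: ae_sub (L2_subE f g) => x /= ->; ring.
have <- : l2norm mu (scalar_field (fun x => f x - phi x - (g x - psi x))) =
   l2norm mu (scalar_field (fun x => L2_sub f g x - (phi x - psi x))).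
  by congr Num.sqrt; apply: eq_inner => // i.
apply: (le_lt_trans (l2normB (sq_int_scalar fpL) (sq_int_scalar gsL))).
by rewrite (splitr e) ltrD.
Qed.

Lemma H1_sub_weak (u v : H1 D) (phi : 'rV[R]_d -> R) (i : 'I_d) :
  test_function D phi ->
  (\int[mu]_x (L2_sub u v x * partial i phi x) =
   - \int[mu]_x (L2_sub (H1_grad u i) (H1_grad v i) x * phi x))%R.
Proof.
move=> tphi; have [_ cpphi] := test_function_derivable i tphi.
have cphi := test_function_continuous tphi.
rewrite !Rintegral_L2_sub; [|exact: continuous_Lfun2..].
by rewrite !H1_weak_gradient// opprB opprK addrC.
Qed.

Definition H1_sub (u v : H1 D) : H1 D := MkH1 (H1_sub_weak u v).

Lemma H01_sub_closure (u v : H01 D) (e : R) : 0 < e ->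
  exists2 phi, test_function D phi &
    (L2norm D (fun x => H1_val (H1_sub u v) x - phi x)%R < e%:E)%E /\
    forall i, (L2norm D
      (fun x => H1_grad (H1_sub u v) i x - partial i phi x)%R < e%:E)%E.
Proof.
move=> e0; have e20 : 0 < e / 2 by rewrite divr_gt0.
have [phi tphi [uphi guphi]] := H01_closure u e20.
have [psi tpsi [vpsi gvpsi]] := H01_closure v e20.
exists (fun x => phi x - psi x); first exact: test_functionB.
have cphi0 := test_function_continuous tphi.
have cpsi0 := test_function_continuous tpsi.
split=> [|i]; first by apply: L2norm_sub_lt => //; exact: continuous_Lfun2.
have [dphi cphi] := test_function_derivable i tphi.
have [dpsi cpsi] := test_function_derivable i tpsi.
rewrite partialB//.
by apply: L2norm_sub_lt; [exact: continuous_Lfun2..|exact: guphi|exact: gvpsi].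
Qed.

Definition H01_sub (u v : H01 D) : H01 D := MkH01 (H01_sub_closure u v).

End sobolev_difference.

(** * The elliptic diffusion problem *)

Lemma le_of_quadratic {R : realType} (m k x : R) : 0 <= x -> 0 <= k ->
  m * x ^+ 2 <= k * x -> m * x <= k.
Proof.
rewrite le_eqVlt => /predU1P[<- k0 _|x0 _]; first by rewrite mulr0.
by rewrite expr2 mulrA ler_pM2r.
Qed.

(** The tangent at s bounds exp from below, hence
    exp s - exp t <= exp s * (s - t). *)
Lemma expR_lipschitz {R : realType} (r s t : R) : s <= r -> t <= r ->
  `|expR s - expR t| <= expR r * `|s - t|.
Proof.
have h s' t' : s' <= r -> expR s' - expR t' <= expR r * `|s' - t'|.
  move=> sr; have := expR_ge1Dx (t' - s').
  rewrite expRB -(ler_pM2l (expR_gt0 s')) mulrCA divff ?gt_eqF ?expR_gt0//.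
  rewrite mulr1.
  move=> st; have : expR s' * (s' - t') <= expR r * `|s' - t'|.
    apply: (@le_trans _ _ (expR s' * `|s' - t'|)).
      by rewrite ler_wpM2l ?expR_ge0// ler_norm.
    by rewrite ler_wpM2r// ler_expR.
  lra.
move=> sr tr; rewrite ler_norml; apply/andP; split; last exact: h.
by rewrite lerNl opprB distrC; exact: h.
Qed.

Section diffusion.
Context {R : realType} {d : nat} (D : lipschitz_domain R d).
Local Notation mu := (lebesgue_on D).
Local Notation T := (rVborel R d).
Implicit Types (u v : H01 D) (a : Linfty_pos D) (f : L2 D) (z w : data D).

Definition gradient (u : H1 D) : 'I_d -> T -> R := fun i => H1_grad u i.

Lemma sq_int_gradient (u : H1 D) : sq_int_field mu (gradient u).
Proof. by move=> i; exact: (L2_Lfun2 (H1_grad u i)). Qed.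

Lemma sq_int_L2 f : sq_int_field mu (scalar_field f).
Proof. exact: sq_int_scalar (L2_Lfun2 f). Qed.

Lemma Linfty_pos_measurable a : measurable_fun setT (a : T -> R).
Proof. exact: measurable_class. Qed.

Lemma L2norm_gradient (u : H1 D) :
  L2norm D (fun x => eucl_norm (H1_grad u ^~ x)) = (l2norm mu (gradient u))%:E.
Proof. exact: Lnorm_field (sq_int_gradient u). Qed.

Lemma H01_distE u v :
  H01_dist D u v = l2norm mu (fun i x => gradient u i x - gradient v i x).
Proof.
have uvL := fieldB (sq_int_gradient u) (sq_int_gradient v).
by rewrite /H01_dist /L2norm (Lnorm_field uvL).
Qed.

Lemma gradient_subE u v i :
  \forall x \ae mu,
    gradient (H01_sub u v) i x = gradient u i x - gradient v i x.
Proof. exact: L2_subE. Qed.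

Lemma H01_dist_sub u v : H01_dist D u v = l2norm mu (gradient (H01_sub u v)).
Proof.
have uvL := fieldB (sq_int_gradient u) (sq_int_gradient v).
have wL := sq_int_gradient (H01_sub u v).
rewrite H01_distE; congr Num.sqrt; apply: eq_inner => //.
  by move=> i; apply: ae_sub (gradient_subE u v i) => x ->.
by move=> i; apply: ae_sub (gradient_subE u v i) => x ->.
Qed.

Lemma l2norm_self {I : finType} (g : I -> T -> R) :
  l2norm mu (fun i x => g i x - g i x) = 0.
Proof.
rewrite /l2norm (_ : inner _ _ _ = 0) ?sqrtr0// /inner /Rintegral.
rewrite -[RHS]/(fine 0%E); congr fine; rewrite -[RHS](@integral0 _ _ _ mu setT).
by apply: eq_integral => x _; rewrite big1// => i _; rewrite subrr mulr0.
Qed.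

Lemma H01_dist_pseudometric : pseudometric (H01_dist D).
Proof.
split=> [u|u v|u v w]; rewrite !H01_distE.
- exact: l2norm_self.
- exact: l2norm_sub_sym.
- by apply: l2norm_triangle; exact: sq_int_gradient.
Qed.

Lemma ae_Linfty_pos_gt0 a : \forall x \ae mu, 0 < a x.
Proof.
apply: ae_sub (ess_inf_le mu (EFin \o a)) => x /= ax.
by rewrite -lte_fin; apply: lt_le_trans ax; exact: Linfty_pos_gt0.
Qed.

(** The coefficient lies between two positive constants: its essential infimum
    and its norm. *)
Lemma Linfty_pos_log_bounded a : exists M, \forall x \ae mu, `|ln (a x)| <= M.
Proof.
have [m m0 ma] : exists2 m : R, 0 < m & \forall x \ae mu, m <= a x.
  have := Linfty_pos_gt0 a; have := ess_inf_le mu (EFin \o a).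
  case: (ess_inf _ _) => [m| |] // ma; rewrite ?lte_fin => m0.
    by exists m => //; apply: ae_sub ma => x /=; rewrite lee_fin.
  (* an infinite essential infimum means that [mu] is zero *)
  by exists 1 => //; apply: ae_sub ma => x /=; rewrite leye_eq.
have [K aK] : exists K : R, \forall x \ae mu, `|a x| <= K.
  have N : ('N[mu]_+oo [EFin \o a] < +oo)%E.
    exact: (@Lebesgue_finite _ _ _ mu +oo%E _ (Linfty_pos_val a)).
  exists (fine ('N[mu]_+oo [EFin \o a])%E).
  apply/Lnorm_infty_le; first by rewrite fine_ge0// Lnorm_ge0.
  by rewrite fineK// ge0_fin_numE// Lnorm_ge0.
exists (`|ln m| + `|ln K|); apply: (ae_sub _ (ae_and ma aK)) => x [mx Kx].
have ax : 0 < a x by exact: lt_le_trans mx.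
have ln1 : ln m <= ln (a x) by rewrite ler_ln.
have ln2 : ln (a x) <= ln K.
  by rewrite gtr0_norm// in Kx; rewrite ler_ln ?posrE// (lt_le_trans ax).
have := ler_norm (ln K); have := ler_norm (- ln m); rewrite normrN => h1 h2.
have := normr_ge0 (ln m); have := normr_ge0 (ln K) => h3 h4.
rewrite ler_norml; apply/andP; split; lra.
Qed.

Lemma log_diff_bounded z w :
  exists M, \forall x \ae mu, `|ln (z.1 x) - ln (w.1 x)| <= M.
Proof.
have [M zM] := Linfty_pos_log_bounded z.1.
have [N wN] := Linfty_pos_log_bounded w.1.
exists (M + N); apply: (ae_sub _ (ae_and zM wN)) => x [zx wx].
by rewrite (le_trans (ler_normB _ _))// lerD.
Qed.

Definition log_dist z w : R :=
  fine (Linfty_norm D (fun x => ln (z.1 x) - ln (w.1 x))).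

Definition source_dist f1 f2 : R :=
  l2norm mu (fun i x => scalar_field f1 i x - scalar_field f2 i x).

Lemma data_distE z w : data_dist D z w =
  log_dist z w + source_dist z.2 w.2.
Proof.
congr (_ + _).
by rewrite (L2norm_scalar (Lfun2B (L2_Lfun2 z.2) (L2_Lfun2 w.2))).
Qed.

Lemma ae_log_dist z w :
  \forall x \ae mu, `|ln (z.1 x) - ln (w.1 x)| <= log_dist z w.
Proof. by have [M] := log_diff_bounded z w; exact: ae_le_Lnorm_infty. Qed.

Lemma log_dist_le z w M : 0 <= M ->
  (\forall x \ae mu, `|ln (z.1 x) - ln (w.1 x)| <= M) -> log_dist z w <= M.
Proof. exact: fine_Lnorm_infty_le. Qed.

Lemma log_dist_ge0 z w : 0 <= log_dist z w.
Proof. by rewrite fine_ge0// Lnorm_ge0. Qed.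

Lemma data_dist_pseudometric : pseudometric (data_dist D).
Proof.
have log_sym z w : log_dist z w <= log_dist w z.
  apply: log_dist_le; first exact: log_dist_ge0.
  by apply: ae_sub (ae_log_dist w z) => x; rewrite distrC.
split=> [z|z w|z w y]; rewrite !data_distE.
- rewrite /source_dist l2norm_self addr0.
  apply/eqP; rewrite eq_le log_dist_ge0 andbT.
  by apply: log_dist_le => //; apply: aeW => x; rewrite subrr normr0.
- congr (_ + _); last exact: l2norm_sub_sym.
  by apply/eqP; rewrite eq_le !log_sym.
have h : log_dist z y <= log_dist z w + log_dist w y.
  apply: log_dist_le; first by rewrite addr_ge0 ?log_dist_ge0.
  apply: (ae_sub _ (ae_and (ae_log_dist z w) (ae_log_dist w y))) => x [zw wy].
  rewrite -[ln (z.1 x)](subrK (ln (w.1 x))) -addrA.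
  by rewrite (le_trans (ler_normD _ _))// lerD.
rewrite addrACA lerD//.
exact: l2norm_triangle (sq_int_L2 z.2) (sq_int_L2 w.2) (sq_int_L2 y.2).
Qed.

Lemma bounded_dataP r z : bounded_data D r z <->
  [/\ 0 <= r, \forall x \ae mu, `|ln (z.1 x)| <= r &
      l2norm mu (scalar_field z.2) <= r].
Proof.
rewrite /bounded_data/= L2norm_scalar ?L2_Lfun2// lee_fin; split.
  move=> [a_r f_r]; have r0 : 0 <= r by apply: le_trans f_r; exact: l2norm_ge0.
  by split => //; apply/Lnorm_infty_le.
by move=> [r0 a_r f_r]; split => //; apply/Lnorm_infty_le.
Qed.

Lemma bounded_data_exists z : exists r, bounded_data D r z.
Proof.
have [M zM] := Linfty_pos_log_bounded z.1.
exists (`|M| + l2norm mu (scalar_field z.2)); apply/bounded_dataP; split.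
- by rewrite addr_ge0// l2norm_ge0.
- apply: ae_sub zM => x xM; rewrite (le_trans xM)// (le_trans (ler_norm _))//.
  by rewrite lerDl l2norm_ge0.
- by rewrite lerDr.
Qed.

Lemma bounded_data_near (r e : R) z w :
  bounded_data D r z -> data_dist D z w <= e -> bounded_data D (r + e) w.
Proof.
have [_ -> _] := data_dist_pseudometric; rewrite data_distE.
move=> bz wz; have [r0 zr fr] := (bounded_dataP r z).1 bz.
have n0 : 0 <= source_dist w.2 z.2 by exact: l2norm_ge0.
have l0 := log_dist_ge0 w z.
have le : log_dist w z <= e by rewrite (le_trans _ wz)// lerDl.
have fe : source_dist w.2 z.2 <= e by rewrite (le_trans _ wz)// lerDr.
apply/bounded_dataP; split; first by rewrite addr_ge0// (le_trans l0).
  apply: (ae_sub _ (ae_and zr (ae_log_dist w z))) => x [zx wzx].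
  rewrite -[ln (w.1 x)](subrK (ln (z.1 x))) addrC.
  by rewrite (le_trans (ler_normD _ _))//; lra.
apply: (le_trans (l2norm_le_sub (sq_int_L2 w.2) (sq_int_L2 z.2))).
by rewrite addrC lerD.
Qed.

Lemma data_dist_bounded r z w : bounded_data D r z -> bounded_data D r w ->
  data_dist D z w <= r *+ 4.
Proof.
move=> bz bw; have [r0 zr fr] := (bounded_dataP r z).1 bz.
have [_ wr gr] := (bounded_dataP r w).1 bw; rewrite data_distE.
have : log_dist z w <= r + r.
  apply: log_dist_le; first by rewrite addr_ge0.
  apply: (ae_sub _ (ae_and zr wr)) => x [zx wx].
  by rewrite (le_trans (ler_normB _ _))// lerD.
have : source_dist z.2 w.2 <= _ := l2normB (sq_int_L2 z.2) (sq_int_L2 w.2).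
lra.
Qed.

Lemma coefficient_bounds a r : (\forall x \ae mu, `|ln (a x)| <= r) ->
  (\forall x \ae mu, expR (- r) <= a x) /\
  (\forall x \ae mu, `|a x| <= expR r).
Proof.
move=> ar; have ap := ae_Linfty_pos_gt0 a.
split; apply: (ae_sub _ (ae_and ap ar)) => x [ax];
  rewrite ler_norml => /andP[lo hi].
  by rewrite -[leRHS]lnK// ler_expR.
by rewrite gtr0_norm// -[leLHS]lnK// ler_expR.
Qed.

Section estimates.
Variable c : R.
Hypothesis hc : poincare_constant D c.

Let c0 : 0 <= c. Proof. by case: hc. Qed.

Lemma poincare v : l2norm mu (scalar_field v) <= c * l2norm mu (gradient v).
Proof.
by have := hc.2 v; rewrite L2norm_gradient L2norm_scalar ?L2_Lfun2.
Qed.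

Lemma weak_solution_inner a f u v : weak_solution a f u ->
  inner mu (fun i x => a x * gradient u i x) (gradient v) =
  inner mu (scalar_field f) (scalar_field v).
Proof.
move=> /(_ v) e; rewrite inner_scalar -e; apply: eq_Rintegral => x _.
by rewrite mulr_sumr; apply: eq_bigr => i _; rewrite mulrA.
Qed.

(** The a priori estimate: test the equation with its solution. *)
Lemma weak_solution_norm a f u m M : weak_solution a f u ->
  (\forall x \ae mu, m <= a x) -> (\forall x \ae mu, `|a x| <= M) ->
  m * l2norm mu (gradient u) <= c * l2norm mu (scalar_field f).
Proof.
move=> au ma aM; apply: le_of_quadratic; rewrite ?mulr_ge0 ?l2norm_ge0//.
rewrite sqr_l2norm.
have ama := Linfty_pos_measurable a.
apply: (le_trans (inner_weight_ge ama aM (sq_int_gradient u) ma)).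
rewrite (weak_solution_inner _ au) (le_trans (ler_norm _))//.
apply: (le_trans (inner_le (sq_int_L2 f) (sq_int_L2 u))).
by rewrite (mulrC c) -mulrA ler_wpM2l ?l2norm_ge0// poincare.
Qed.

(** Stability: test the difference of the equations with the difference of the
    solutions; the perturbation of the coefficient acts on the gradient of the
    second solution. *)
Lemma weak_solution_stability a1 a2 f1 f2 u1 u2 m M1 M2 K :
  weak_solution a1 f1 u1 -> weak_solution a2 f2 u2 ->
  (\forall x \ae mu, m <= a1 x) -> (\forall x \ae mu, `|a1 x| <= M1) ->
  (\forall x \ae mu, `|a2 x| <= M2) ->
  0 <= K -> (\forall x \ae mu, `|a1 x - a2 x| <= K) ->
  m * H01_dist D u1 u2 <=
  c * source_dist f1 f2 + K * l2norm mu (gradient u2).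
Proof.
move=> au1 au2 ma aM1 aM2 K0 aK; rewrite H01_dist_sub.
set w := H01_sub u1 u2.
have ma1 := Linfty_pos_measurable a1; have ma2 := Linfty_pos_measurable a2.
have ma12 : measurable_fun setT (fun x => a1 x - a2 x).
  exact: measurable_funB.
have [g1 g2] := (sq_int_gradient u1, sq_int_gradient u2).
have gw := sq_int_gradient w.
set F := source_dist f1 f2; set G := l2norm mu (gradient u2).
have [F0 G0] : 0 <= F /\ 0 <= G by split; exact: l2norm_ge0.
apply: le_of_quadratic.
- exact: l2norm_ge0.
- by rewrite addr_ge0 ?mulr_ge0.
rewrite sqr_l2norm.
apply: (le_trans (inner_weight_ge ma1 aM1 gw ma)).
have K12L := field_weight ma12 aK g2.
have e1L := field_weight ma1 aM1 g1; have e2L := field_weight ma2 aM2 g2.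
have e1w := field_weight ma1 aM1 gw; have e12 := fieldB e1L (fieldD e2L K12L).
(* the difference of the two weak formulations tested with w *)
have -> : inner mu (fun i x => a1 x * gradient w i x) (gradient w) =
    inner mu (fun i x => scalar_field f1 i x - scalar_field f2 i x)
      (scalar_field w) -
    inner mu (fun i x => (a1 x - a2 x) * gradient u2 i x) (gradient w).
  have -> : inner mu (fun i x => a1 x * gradient w i x) (gradient w) =
      inner mu (fun i x => a1 x * gradient u1 i x -
        (a2 x * gradient u2 i x + (a1 x - a2 x) * gradient u2 i x))
      (gradient w).
    apply: eq_inner => //.
    - by move=> i; apply: ae_sub (gradient_subE u1 u2 i) => x ->; ring.
    - by move=> i; apply: aeW.
  rewrite (innerBl e1L (fieldD e2L K12L) gw) (innerDl e2L K12L gw).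
  rewrite (weak_solution_inner w au1) (weak_solution_inner w au2).
  rewrite (innerBl (sq_int_L2 f1) (sq_int_L2 f2) (sq_int_L2 w)); ring.
have fL := fieldB (sq_int_L2 f1) (sq_int_L2 f2).
rewrite mulrDl; apply: lerD.
  apply: (le_trans (ler_norm _)); apply: (le_trans (inner_le fL (sq_int_L2 w))).
  by rewrite (mulrC c) -mulrA ler_wpM2l// poincare.
apply: (le_trans (ler_norm _)); rewrite normrN.
apply: (le_trans (inner_le K12L gw)).
by rewrite ler_wpM2r ?l2norm_ge0//; exact: l2norm_weight.
Qed.

Lemma solution_norm r z u : bounded_data D r z -> weak_solution z.1 z.2 u ->
  l2norm mu (gradient u) <= c * r * expR r.
Proof.
move=> bz zu; have [r0 zr fr] := (bounded_dataP r z).1 bz.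
have [lo hi] := coefficient_bounds zr.
have := weak_solution_norm zu lo hi.
rewrite expRN mulrC ler_pdivrMr ?expR_gt0// => h.
by rewrite (le_trans h)// ler_wpM2r ?expR_ge0// ler_wpM2l.
Qed.

Lemma solution_lipschitz r z1 z2 u1 u2 :
  bounded_data D r z1 -> bounded_data D r z2 ->
  weak_solution z1.1 z1.2 u1 -> weak_solution z2.1 z2.2 u2 ->
  H01_dist D u1 u2 <= c * (1 + r) * expR (3 * r) * data_dist D z1 z2.
Proof.
move=> b1 b2 zu1 zu2; have gu2 := solution_norm b2 zu2.
have [r0 zr1 fr1] := (bounded_dataP r z1).1 b1.
have [_ zr2 fr2] := (bounded_dataP r z2).1 b2.
have [lo1 hi1] := coefficient_bounds zr1.
have [lo2 hi2] := coefficient_bounds zr2.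
have l0 := log_dist_ge0 z1 z2.
have K0 : 0 <= expR r * log_dist z1 z2 by rewrite mulr_ge0 ?expR_ge0.
have aK : \forall x \ae mu, `|z1.1 x - z2.1 x| <= expR r * log_dist z1 z2.
  have p1 := ae_Linfty_pos_gt0 z1.1; have p2 := ae_Linfty_pos_gt0 z2.1.
  have zl := ae_and (ae_and zr1 zr2) (ae_log_dist z1 z2).
  apply: (ae_sub _ (ae_and (ae_and p1 p2) zl)).
  move=> x [[x1 x2] [[xr1 xr2] xl]].
  have {}xr1 := le_trans (ler_norm _) xr1.
  have {}xr2 := le_trans (ler_norm _) xr2.
  rewrite -{1}[z1.1 x]lnK// -{1}[z2.1 x]lnK//.
  rewrite (le_trans (expR_lipschitz xr1 xr2))//.
  by rewrite ler_wpM2l ?expR_ge0.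
have := weak_solution_stability zu1 zu2 lo1 hi1 hi2 K0 aK.
rewrite data_distE; set F := source_dist _ _; set l := log_dist _ _.
have F0 : 0 <= F by exact: l2norm_ge0.
rewrite expRN mulrC ler_pdivrMr ?expR_gt0// => h.
apply: (le_trans h).
have e1 : 1 <= expR r by rewrite -expR0 ler_expR.
have -> : expR (3 * r) = expR r ^+ 3 by rewrite -expRM_natl.
have hg : expR r * l * l2norm mu (gradient u2) <= expR r * l * (c * r * expR r).
  by rewrite ler_wpM2l.
move: e1 hg K0; set E := expR r => e1 hg K0.
(* insert the a priori estimate for u2; then E <= E^3 brings the terms in F and
   in l to a common power of E *)
apply: (@le_trans _ _ ((c * F + E * l * (c * r * E)) * E)).
  by rewrite ler_wpM2r ?expR_ge0// lerD2l.
rewrite -subr_ge0.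
have -> : c * (1 + r) * E ^+ 3 * (l + F) - (c * F + E * l * (c * r * E)) * E =
  c * (E ^+ 3 * l + r * E ^+ 3 * F + (E ^+ 3 - E) * F) by ring.
have E3 : 0 <= E ^+ 3 - E.
  have -> : E ^+ 3 - E = E * (E - 1) * (E + 1) by ring.
  by rewrite !mulr_ge0//; lra.
have E30 : 0 <= E ^+ 3 by rewrite exprn_ge0//; lra.
have rE30 : 0 <= r * E ^+ 3 by exact: mulr_ge0.
apply: mulr_ge0; first exact: c0.
by apply: addr_ge0; [apply: addr_ge0|]; apply: mulr_ge0.
Qed.

End estimates.
End diffusion.

Section solution_operator.
Context {R : realType} {d : nat} (D : lipschitz_domain R d).
Variables (c : R) (hc : poincare_constant D c).
Variables (S : data D -> H01 D) (hS : solution_operator S).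

Lemma solution_operator_lipschitz r z w :
  bounded_data D r z -> bounded_data D r w ->
  H01_dist D (S z) (S w) <= c * (1 + r) * expR (3 * r) * data_dist D z w.
Proof.
move=> bz bw; apply: (solution_lipschitz hc bz bw).
  by case: z bz => a f _; exact: hS.
by case: w bw => a f _; exact: hS.
Qed.

Lemma lipschitz_constant_ge0 r : 0 <= r -> 0 <= c * (1 + r) * expR (3 * r).
Proof. by move=> r0; rewrite !mulr_ge0 ?hc.1 ?addr_ge0 ?expR_ge0. Qed.

Lemma solution_operator_continuous :
  dist_continuous (data_dist D) (H01_dist D) S.
Proof.
move=> z e e0; have [r bz] := bounded_data_exists z.
have [r0 _ _] := (bounded_dataP r z).1 bz.
have bz1 : bounded_data D (r + 1) z.
  apply: (bounded_data_near bz); have [-> _ _] := data_dist_pseudometric D.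
  exact: ler01.
pose L := c * (1 + (r + 1)) * expR (3 * (r + 1)).
have L0 : 0 <= L by apply: lipschitz_constant_ge0; rewrite addr_ge0.
have L1 : 0 < L + 1 by rewrite ltr_wpDl.
(* L may vanish, hence the denominator L + 1 *)
exists (Num.min 1 (e / (L + 1))); first by rewrite lt_min ltr01 divr_gt0.
move=> w; rewrite lt_min => /andP[zw1 zwe].
have bw1 := bounded_data_near bz (ltW zw1).
apply: (le_lt_trans (solution_operator_lipschitz bz1 bw1)); rewrite -/L.
apply: (@le_lt_trans _ _ ((L + 1) * data_dist D z w)).
  rewrite ler_wpM2r ?lerDl//; exact: dist_ge0 (data_dist_pseudometric D) _ _.
by rewrite mulrC -ltr_pdivlMr.
Qed.

End solution_operator.

Lemma ae_of_support {R : realType} {X : pointedType} (dist : X -> X -> R)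
    (P : probability (dist_borel dist) R) (C B : set X) :
  is_support P C -> C `<=` B -> \forall x \ae P, B x.
Proof.
move=> [oC PC _] CB; exists (~` C); split => //.
  exact: dist_open_measurable.
by move=> x /= nB /CB.
Qed.

Theorem corollary3p3 (R : realType) (d : nat) (hd : d = 2%N \/ d = 3%N)
    (D : lipschitz_domain R d)
    (S : data D -> H01 D) (hS : solution_operator S)
    (c : R) (hc : poincare_constant D c)
    (p r : R) (hp : 1 <= p)
    (P Q : probability (dist_borel (data_dist D)) R)
    (suppP suppQ : set (data D))
    (hP : is_support P suppP) (hQ : is_support Q suppQ)
    (hPr : suppP `<=` bounded_data D r) (hQr : suppQ `<=` bounded_data D r) :
  exists S' : {mfun dist_borel (data_dist D) >->
                    dist_borel (H01_dist D)},
    [/\ (S' : data D -> H01 D) = S,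
        wasserstein_space p (distribution P S'),
        wasserstein_space p (distribution Q S') &
        (wasserstein p (distribution P S') (distribution Q S') <=
         (c * (1 + r) * expR (3 * r))%:E * wasserstein p P Q)%E].
Proof.
have cS := solution_operator_continuous hc hS.
have mS := dist_continuous_measurable cS.
have [dP dH] := (data_dist_pseudometric D, H01_dist_pseudometric D).
have [aeP aeQ] := (ae_of_support hP hPr, ae_of_support hQ hQr).
have lipS r' z w := @solution_operator_lipschitz _ _ _ _ hc _ hS r' z w.
have L0 : 0 <= c * (1 + r) * expR (3 * r).
  have [z bz] := ae_probability_nonempty aeP.
  have [r0 _ _] := (bounded_dataP r z).1 bz.
  exact: lipschitz_constant_ge0 hc _ r0.
have bd z w : bounded_data D r z -> bounded_data D r w ->
  data_dist D z w <= r *+ 4 by exact: data_dist_bounded.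
have [S' S'E] : exists S' : {mfun dist_borel (data_dist D) >->
    dist_borel (H01_dist D)}, (S' : data D -> H01 D) = S.
  by exists (mfun_Sub (rT := dist_borel (H01_dist D)) (mem_set mS)).
rewrite -S'E in cS lipS.
exists S'; split; first exact: S'E.
- exact: (wasserstein_space_pushforward dP dH (lipS r) hp aeP bd L0).
- exact: (wasserstein_space_pushforward dP dH (lipS r) hp aeQ bd L0).
- exact: (wasserstein_pushforward dP dH cS (lipS r) hp L0 aeP aeQ).
Qed.
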